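(* Let $\mathbf{A}$ be an $n\times n$ real symmetric matrix, and let $0<\eta<1$ and $t>0$. Let $n_{\mathrm{v}}$ and $k$ be positive integers with $n_{\mathrm{v}} > 4(n+2)^{-1}t^{-2}\ln(2n\eta^{-1})$ and $k > 12t^{-1}+\tfrac12$. Let $\mathbf{v}_1,\dots,\mathbf{v}_{n_{\mathrm{v}}}$ be drawn independently and uniformly from the unit sphere $\mathcal{S}^{n-1}\subset\mathbb{R}^n$, set $\Psi_i=\Psi[\mathbf{A},\mathbf{v}_i]$, and let the stochastic Lanczos quadrature output be $\frac{1}{n_{\mathrm{v}}}\sum_{i=1}^{n_{\mathrm{v}}}\mathrm{GQ}_k(\Psi_i)$. Then $$\mathbb{P}\Big[d_{\mathrm{W}}\Big(\Phi[\mathbf{A}],\ \tfrac{1}{n_{\mathrm{v}}}\textstyle\sum_{i=1}^{n_{\mathrm{v}}}\mathrm{GQ}_k(\Psi_i)\Big) > t\, I[\mathbf{A}]\Big] < \eta,$$ where $I[\mathbf{A}] := |\lambda_{\max}[\mathbf{A}]-\lambda_{\min}[\mathbf{A}]|$.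
   Context: For a symmetric matrix $\mathbf{A}$ with eigendecomposition $\mathbf{A}=\mathbf{U}\boldsymbol{\Lambda}\mathbf{U}^{\mathsf T}$ and $x\in\mathbb{R}$, $\mathbb{1}[\mathbf{A}\le x]$ denotes the orthogonal projector onto the span of eigenvectors whose eigenvalues are $\le x$. The cumulative empirical spectral measure (CESM) is $\Phi[\mathbf{A}](x)=\frac1n\sum_{i=1}^n\mathbb{1}[\lambda_i[\mathbf{A}]\le x]=\frac1n\operatorname{tr}(\mathbb{1}[\mathbf{A}\le x])$. For a unit vector $\mathbf{v}$, the weighted CESM is $\Psi[\mathbf{A},\mathbf{v}](x)=\mathbf{v}^{\mathsf T}\mathbb{1}[\mathbf{A}\le x]\mathbf{v}$, a probability distribution function. For a probability distribution function $\mu$, the $k$-point Gaussian quadrature rule $\mathrm{GQ}_k(\mu)$ is the distribution function $\nu(x)=\sum_{j=1}^k d_j\mathbb{1}[\theta_j\le x]$ (nodes $\theta_j$, nonnegative weights $d_j$) such that $\int p\,d\mu=\int p\,d\nu$ for all polynomials $p$ of degree $\le 2k-1$; for $\mu=\Psi[\mathbf{A},\mathbf{v}]$ it equals $\Psi[\mathbf{T}_k,\hat{\mathbf{e}}]$, where $\mathbf{T}_k$ is the $k\times k$ tridiagonal matrix produced by $k$ steps of the Lanczos algorithm on $\mathbf{A},\mathbf{v}$ and $\hat{\mathbf{e}}=(1,0,\dots,0)^{\mathsf T}$ (its nodes are the eigenvalues of $\mathbf{T}_k$ and weights the squared first components of its normalized eigenvectors). The Wasserstein distance between distribution functions is $d_{\mathrm{W}}(\mu,\nu)=\int_{\mathbb{R}}|\mu(x)-\nu(x)|\,dx$.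 *)

(* Defs.v *)
From HB Require Import structures.
From mathcomp Require Import all_boot all_order all_algebra.
From mathcomp Require Import all_classical all_reals all_analysis.

Set Implicit Arguments.
Unset Strict Implicit.
Unset Printing Implicit Defensive.

Import Order.TTheory GRing.Theory Num.Theory.

Local Open Scope classical_set_scope.
Local Open Scope ring_scope.

(* Spectral objects of A = U diag(lam) U^T  (U orthogonal).            *)

Definition indic_le {R : realType} (a x : R) : R := if a <= x then 1 else 0.

(* 1[A <= x] = U diag(1[lam_i <= x]) U^T : orthogonal projector onto the span
   of the eigenvectors (columns of U) whose eigenvalues are <= x. *)
Definition spec_proj_le {R : realType} {n : nat} (U : 'M[R]_n) (lam : 'I_n -> R)
  (x : R) : 'M[R]_n :=
  U *m diag_mx (\row_i indic_le (lam i) x) *m U^T.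

Definition CESM {R : realType} {n : nat} (lam : 'I_n -> R) (x : R) : R :=
  (n%:R)^-1 * \sum_(i < n) indic_le (lam i) x.

Definition wCESM {R : realType} {n : nat} (U : 'M[R]_n) (lam : 'I_n -> R)
  (v : 'cV[R]_n) (x : R) : R :=
  (v^T *m spec_proj_le U lam x *m v) 0 0.

(* lambda_max, lambda_min (the default value is irrelevant when n > 0) *)
Definition lam_max {R : realType} {n : nat} (lam : 'I_n -> R) : R :=
  \big[Num.max/head 0 [seq lam i | i <- enum 'I_n]]_(i < n) lam i.
Definition lam_min {R : realType} {n : nat} (lam : 'I_n -> R) : R :=
  \big[Num.min/head 0 [seq lam i | i <- enum 'I_n]]_(i < n) lam i.

Definition spec_width {R : realType} {n : nat} (lam : 'I_n -> R) : R :=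
  `|lam_max lam - lam_min lam|.

Definition step_cdf {R : realType} {m : nat} (theta d : 'I_m -> R) (x : R) : R :=
  \sum_(j < m) d j * indic_le (theta j) x.

(* nu is the k-point Gaussian quadrature rule GQ_k(mu): nu has k nodes with
   nonnegative weights, and int p dnu = int p dmu for every polynomial of
   degree <= 2k-1 (i.e. size <= 2k).  The integral of p against a finitely
   supported distribution function mu = sum_i w_i 1[lam_i <= x] is
   sum_i w_i p(lam_i) (for any such representation of mu). *)
Definition is_GQ {R : realType} (k : nat) (mu nu : R -> R) : Prop :=
  exists theta d : 'I_k -> R,
    (forall j, 0 <= d j) /\ nu = step_cdf theta d /\
    forall p : {poly R}, (size p <= 2 * k)%N ->
      forall (m : nat) (lam w : 'I_m -> R), mu = step_cdf lam w ->
        \sum_(i < m) w i * p.[lam i] = \sum_(j < k) d j * p.[theta j].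

(* GQ_k(mu) (well defined: the Gaussian quadrature rule is unique as a
   distribution function; it exists for finitely supported mu). *)
Definition GQ {R : realType} (k : nat) (mu : R -> R) : R -> R :=
  match pselect (exists nu, is_GQ k mu nu) with
  | left h => proj1_sig (cid h)
  | right _ => fun _ => 0
  end.

Definition dW {R : realType} (mu nu : R -> R) : \bar R :=
  (\int[@lebesgue_measure R]_(x in setT) (`|mu x - nu x|)%:E)%E.

(* coordinates of a column vector, as an element of the measurable space
   n.-tuple R (product Borel sigma-algebra) *)
Definition col2tup {R : realType} {n : nat} (c : 'cV[R]_n) : n.-tuple R :=
  [tuple c i 0 | i < n].

Definition random_vector {d} {T : measurableType d} {R : realType} {n : nat}
  (v : T -> 'cV[R]_n) : Prop :=
  measurable_fun setT (fun w => col2tup (v w)).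

(* v is uniformly distributed on the unit sphere S^{n-1}: it lies on the
   sphere almost surely and its law is invariant under every orthogonal
   transformation (this characterizes the normalized surface measure). *)
Definition uniform_on_sphere {d} {T : measurableType d} {R : realType} {n : nat}
  (P : probability T R) (v : T -> 'cV[R]_n) : Prop :=
  P [set w | \sum_(i < n) (v w i 0) ^+ 2 = 1] = 1%E /\
  forall Q : 'M[R]_n, Q^T *m Q = 1%:M ->
    forall B : set (n.-tuple R), measurable B ->
      P [set w | B (col2tup (v w))] = P [set w | B (col2tup (Q *m v w))].

Definition mutually_independent {d} {T : measurableType d} {R : realType}
  {n m : nat} (P : probability T R) (v : 'I_m -> T -> 'cV[R]_n) : Prop :=
  forall B : 'I_m -> set (n.-tuple R), (forall i, measurable (B i)) ->
    P (\bigcap_(i in [set: 'I_m]) [set w | B i (col2tup (v i w))]) =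
    (\prod_(i < m) P [set w | B i (col2tup (v i w))])%E.

(* Main.v *)
Require Import Defs.
From HB Require Import structures.
From mathcomp Require Import all_boot all_order all_algebra.
From mathcomp Require Import all_classical all_reals all_analysis.
From mathcomp Require Import measurable_realfun spectral sesquilinear complex.
From mathcomp Require Import ring lra zify.
Set Implicit Arguments.
Unset Strict Implicit.
Unset Printing Implicit Defensive.
Import Order.TTheory GRing.Theory Num.Theory.
Import numFieldNormedType.Exports.
Local Open Scope classical_set_scope.
Local Open Scope ring_scope.

(** Write [u = U^T v]. Then [Psi[A, v]] is the step function with mass [u_l^2] at
    [lam_l], and the distance splits as
    [d_W (Phi, mean Psi_i) + mean d_W (Psi_i, GQ_k Psi_i)], each term at most
    [t / 2] times the spectral width.

    Deterministic part: by duality [d_W (Psi_i, GQ_k Psi_i)] is the difference of the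
    integrals of a 1-Lipschitz function, which Jackson's theorem approximates by a
    polynomial of degree [2k - 1], on which both integrals agree. The rule exists
    because the compression of [diag lam] to a Krylov space of dimension [k] keeps
    the first [2k] moments.

    Random part: for a set [A] of [m] indices put [X = sum_(l in A) u_l^2].
    Differentiating the invariance under plane rotations gives
    [E[(n X - m) e^(s X)] = 2 s E[X (1 - X) e^(s X)]], a second order linear
    equation for the moment generating function of [X]. As [y (1 - y) <= 1/4], it
    yields [E e^(s (X - m/n)) <= e^(s^2 / (4 (n + 2)))] for [s >= 0]; Chernoff's bound
    and a union bound over the [n] eigenvalues and the two tails conclude. *)

(** * Gaussian quadrature of finitely supported measures *)

(** This is Kummer's equation with parameters [m / 2] and [n / 2]. It is singular at [0], so the
    comparison argument needs an integrating factor that vanishes there. Only [s >= 0] is treated: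
    the lower tail of the mass on [A] is the upper tail of the mass on its complement. Step
    functions are constant between eigenvalues, which is why [n] points suffice for the union bound.
    On the deterministic side, the approximating polynomial is controlled only on the spectral
    interval, so the nodes that carry mass must first be shown to lie in it. Constants: an error
    [3 / k] times half the width is paid once for [Psi_i] and once for its rule, which makes [3 / k]
    times the width, and [k > 12 / t]. With deviation [t / 2], each of the [2 n] tails has
    probability at most [exp (- nv (n + 2) t^2 / 4)], and the bound on [nv] makes this smaller than
    [eta / (2 n)]. *)

Lemma iter_mul_diag_mx (K : comPzRingType) (m : nat) (D v : 'rV[K]_m) (r : nat) :
  iter r (mulmxr (diag_mx D)) v = \row_j (v 0 j * D 0 j ^+ r).
Proof.
elim: r => [|r IHr] /=; first by apply/rowP => j; rewrite mxE expr0 mulr1.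
by rewrite IHr; apply/rowP => j; rewrite mul_mx_diag !mxE exprSr mulrA.
Qed.

Section krylov.
Local Open Scope sesquilinear_scope.

(* The compression of [diag_mx D] to its [k]-dimensional Krylov space at [v] has
   the same moments up to order [2k - 1]; its spectral decomposition gives the
   nodes and the weights. *)
Lemma krylov_moments (C : numClosedFieldType) (m k : nat) (D v : 'rV[C]_m) :
  (0 < k <= m)%N -> D \is a realmx ->
  exists th e : 'rV[C]_k, th \is a realmx /\
    forall r, (r < 2 * k)%N ->
      \sum_j v 0 j * (v 0 j)^* * D 0 j ^+ r =
      \sum_j e 0 j * (e 0 j)^* * th 0 j ^+ r.
Proof.
move=> /andP[k_gt0 km] Dreal.
have moment p (E w : 'rV[C]_p) i j : E \is a realmx ->
    (iter i (mulmxr (diag_mx E)) w *m (iter j (mulmxr (diag_mx E)) w)^t*) 0 0 =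
    \sum_l w 0 l * (w 0 l)^* * E 0 l ^+ (i + j).
  move=> /mxOverP Ereal; rewrite !iter_mul_diag_mx mxE; apply: eq_bigr => l _.
  by rewrite !mxE rmorphM rmorphXn/= (conj_Creal (Ereal 0 l)) mulrACA -exprD.
set A := diag_mx D.
pose V : 'M[C]_(k, m) := \matrix_(i < k) iter i (mulmxr A) v.
(* The Krylov vectors may be linearly dependent; since [k <= m], Gram-Schmidt still returns [k]
   orthonormal rows, whose span contains them. *)
pose B := schmidt V.
have BB : B *m B^t* = 1%:M by apply/unitarymxP/schmidt_unitarymx.
have Vproj i : (i < k)%N ->
    iter i (mulmxr A) v *m B^t* *m B = iter i (mulmxr A) v.
  move=> ik; have /submxP[Z VE] := schmidt_sub V.
  have <- : row (Ordinal ik) V = iter i (mulmxr A) v by rewrite rowK.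
  by rewrite VE row_mul -/B -!mulmxA [B *m (B^t* *m _)]mulmxA BB mul1mx.
pose T := B *m A *m B^t*.
pose e := v *m B^t*.
(* Passing from [i] to [i + 1] only requires the vector of order [i < k] to lie in the span, so the
   identity reaches [i = k], one order beyond the Krylov space. *)
have krylovT i : (i <= k)%N -> iter i (mulmxr T) e = iter i (mulmxr A) v *m B^t*.
  elim: i => [//|i IHi] ik; rewrite iterS IHi ?(ltnW ik)//=.
  by rewrite /T !mulmxA Vproj.
have Therm : T \is hermsymmx.
  apply/is_hermitianmxP; rewrite expr0 scale1r /T !trmx_mul !map_mxM /= trmxCK.
  rewrite tr_diag_mx map_diag_mx mulmxA; congr (_ *m diag_mx _ *m _).
  by rewrite realmxC.
have /hermitian_spectral_diag_real threal := Therm.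
have /hermitian_normalmx/orthomx_spectralP := Therm.
have Punit := spectral_unitarymx T.
rewrite (invmx_unitary Punit); set P := spectralmx T in Punit *.
set th := spectral_diag T in threal * => TE.
have PP : P *m P^t* = 1%:M by apply/unitarymxP.
have PP' : P^t* *m P = 1%:M by apply: mulmx1C.
pose e' := e *m P^t*.
have krylovP i : iter i (mulmxr T) e = iter i (mulmxr (diag_mx th)) e' *m P.
  elim: i => [|i IHi]; first by rewrite /= /e' -mulmxA PP' mulmx1.
  rewrite !iterS IHi/= [in X in _ *m P *m X]TE.
  by rewrite -!mulmxA [P *m (P^t* *m _)]mulmxA PP mul1mx.
exists th, e'; split=> // r r2k.
(* A moment of order [r <= 2k - 1] splits as [i + j] with [i <= k - 1] and [j <= k]. The projection
   inserted between the two factors is absorbed by the first one, so the second may have order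
   [k]. *)
pose i := minn r k.-1; pose j := (r - i)%N.
have ik : (i < k)%N by rewrite /i; lia.
have jk : (j <= k)%N by rewrite /j /i; lia.
have ijr : (i + j)%N = r by rewrite /j subnKC// geq_minl.
rewrite -ijr -!moment//.
have -> : iter i (mulmxr (diag_mx th)) e' = iter i (mulmxr T) e *m P^t*.
  by rewrite krylovP -mulmxA PP mulmx1.
have -> : iter j (mulmxr (diag_mx th)) e' = iter j (mulmxr T) e *m P^t*.
  by rewrite krylovP -mulmxA PP mulmx1.
rewrite trmx_mul map_mxM /= trmxCK mulmxA -[_ *m P^t* *m P]mulmxA PP' mulmx1.
rewrite krylovT ?(ltnW ik)// krylovT// trmx_mul map_mxM /= trmxCK mulmxA.
by rewrite Vproj.
Qed.

End krylov.

(** With at most [k] atoms the measure is its own rule, padded with zero weights. Otherwise the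
    Krylov compression applies; the spectral theorem needs a closed field, hence the passage through
    [R[i]], where the starting vector has coordinates [sqrt w_j] so that its squared moduli are the
    weights. All quantities are real, and taking real parts leads back to [R]. *)
Lemma gauss_quadrature_exists (R : rcfType) (m k : nat) (lam w : 'I_m -> R) :
  (0 < k)%N -> (forall i, 0 <= w i) ->
  exists theta d : 'I_k -> R, (forall j, 0 <= d j) /\
    forall p : {poly R}, (size p <= 2 * k)%N ->
      \sum_(i < m) w i * p.[lam i] = \sum_(j < k) d j * p.[theta j].
Proof.
move=> k_gt0 w0; have [mk|km] := leqP m k.
  pose ext (f : 'I_m -> R) (j : 'I_k) : R := oapp f 0 (insub (val j)).
  exists (ext lam), (ext w); split=> [j|p _].
    by rewrite /ext; case: insubP => //= i _ _.
  rewrite (bigID (fun j : 'I_k => (j < m)%N))/= [X in _ = _ + X]big1 ?addr0; last first.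
    by move=> j jm; rewrite /ext insubF ?mul0r//; apply/negbTE.
  rewrite (big_ord_narrow mk).
  by apply: eq_bigr => i _; rewrite /ext /= (valK i).
pose C : numClosedFieldType := R[i]%C.
pose D : 'rV[C]_m := \row_j (lam j)%:C%C.
pose v : 'rV[C]_m := \row_j (Num.sqrt (w j))%:C%C.
have Dreal : D \is a realmx.
  by apply/mxOverP => i j; rewrite mxE; apply/complex_realP; exists (lam j).
have [|th [e [threal moments]]] := @krylov_moments C m k D v _ Dreal.
  by rewrite k_gt0 ltnW.
exists (fun j => complex.Re (th 0 j)), (fun j => complex.Re (e 0 j * (e 0 j)^*)).
split=> [j|p szp].
  by have := mul_conjC_ge0 (e 0 j); rewrite lecE => /andP[].
have {}moments r : (r < 2 * k)%N -> \sum_i w i * lam i ^+ r =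
    \sum_j complex.Re (e 0 j * (e 0 j)^*) * complex.Re (th 0 j) ^+ r.
  move=> /moments rk; apply: (@complexI R); rewrite !rmorph_sum/=.
  transitivity (\sum_j v 0 j * (v 0 j)^* * D 0 j ^+ r).
    apply: eq_bigr => j _; rewrite !mxE.
    have -> : ((Num.sqrt (w j))%:C%C : C)^* = (Num.sqrt (w j))%:C%C.
      by apply/conj_Creal/complex_realP; exists (Num.sqrt (w j)).
    by rewrite -rmorphM -expr2 sqr_sqrtr// -rmorphXn -rmorphM.
  rewrite rk; apply: eq_bigr => j _; rewrite rmorphM rmorphXn/=.
  have /RRe_real := mxOverP threal 0 j.
  have /ger0_real/RRe_real := mul_conjC_ge0 (e 0 j).
  by move=> -> ->.
under eq_bigr do rewrite (horner_coef_wide _ szp) mulr_sumr.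
under [RHS]eq_bigr do rewrite (horner_coef_wide _ szp) mulr_sumr.
rewrite exchange_big [RHS]exchange_big/=; apply: eq_bigr => r _.
under eq_bigr do rewrite mulrCA; under [RHS]eq_bigr do rewrite mulrCA.
by rewrite -!mulr_sumr moments.
Qed.

(** Provides a point where a step function with nodes in [s] already takes its left limit at [y];
    this replaces a limit when an atom is read off as a jump. *)
Lemma seq_left_gap (R : realDomainType) (s : seq R) (y : R) :
  exists2 z, z < y & forall x, x \in s -> x < y -> x <= z.
Proof.
elim: s => [|x s [z zy sz]]; first by exists (y - 1) => //; rewrite gtrBl.
have [xy|yx] := ltP x y; last first.
  exists z => // u; rewrite inE => /orP[/eqP -> /lt_le_trans/(_ yx)|]; first by rewrite ltxx.
  exact: sz.
exists (Num.max x z) => [|u]; first by rewrite gt_max xy zy.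
by rewrite inE le_max => /orP[/eqP ->|us uy]; rewrite ?lexx// sz ?orbT.
Qed.

Lemma sum_by_value (R : pzRingType) (V : eqType) (m : nat) (lam : 'I_m -> V)
    (w : 'I_m -> R) (g : V -> R) (s : seq V) :
  uniq s -> (forall i, lam i \in s) ->
  \sum_i w i * g (lam i) = \sum_(y <- s) (\sum_(i | lam i == y) w i) * g y.
Proof.
move=> us lams; under [RHS]eq_bigr do rewrite mulr_suml big_mkcond.
rewrite exchange_big/=; apply: eq_bigr => i _.
rewrite (bigD1_seq (lam i))//= eqxx big1 ?addr0// => y /negbTE.
by rewrite eq_sym => ->.
Qed.

Lemma step_cdf_atom (R : realType) (m : nat) (lam w : 'I_m -> R) (y z : R) :
  z < y -> (forall i, lam i < y -> lam i <= z) ->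
  step_cdf lam w y - step_cdf lam w z = \sum_(i | lam i == y) w i.
Proof.
move=> zy lamz; rewrite /step_cdf -sumrB [RHS]big_mkcond; apply: eq_bigr => i _.
rewrite /indic_le; case: (ltgtP (lam i) y) => [iy|yi|->].
- by rewrite lamz// subrr.
- by rewrite leNgt (lt_trans zy yi)/= subrr.
- by rewrite leNgt zy/= mulr1 mulr0 subr0.
Qed.

(** A step function has many representations (repeated nodes, zero weights), and [is_GQ] quantifies
    over all of them. The total weight at each value is a jump of the function, hence independent of
    the representation. *)
Lemma step_cdf_integral (R : realType) (m m' : nat) (lam w : 'I_m -> R)
    (lam' w' : 'I_m' -> R) (g : R -> R) :
  step_cdf lam w = step_cdf lam' w' ->
  \sum_i w i * g (lam i) = \sum_i w' i * g (lam' i).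
Proof.
move=> eqF; pose s := undup ([seq lam i | i : 'I_m] ++ [seq lam' i | i : 'I_m']).
rewrite (@sum_by_value _ _ _ _ _ _ s) ?undup_uniq//; last first.
  by move=> i; rewrite mem_undup mem_cat map_f ?mem_enum.
rewrite (@sum_by_value _ _ _ _ w' _ s) ?undup_uniq//; last first.
  by move=> i; rewrite mem_undup mem_cat map_f ?mem_enum ?orbT.
apply: eq_bigr => y _; congr (_ * _).
have [z zy sz] := seq_left_gap s y.
rewrite -(step_cdf_atom _ zy); last first.
  by move=> i; apply: sz; rewrite mem_undup mem_cat map_f ?mem_enum.
rewrite -(step_cdf_atom _ zy) ?eqF// => i; apply: sz.
by rewrite mem_undup mem_cat map_f ?mem_enum ?orbT.
Qed.

(** Existence excludes the default branch of [GQ], the zero function; exactness for one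
    representation extends to all the others. *)
Lemma GQ_spec (R : realType) (m k : nat) (lam w : 'I_m -> R) :
  (0 < k)%N -> (forall i, 0 <= w i) ->
  is_GQ k (step_cdf lam w) (GQ k (step_cdf lam w)).
Proof.
move=> k0 w0; rewrite /GQ; case: pselect => [h|[]]; first by case: cid.
have [th [d [d0 dp]]] := @gauss_quadrature_exists R m k lam w k0 w0.
exists (step_cdf th d), th, d; split=> //; split=> // p szp m' lam' w' E.
by rewrite -dp// (step_cdf_integral (horner p) E).
Qed.

(* Test the rule on [sg (c - X) Q^2] with [Q] vanishing at the other nodes. *)
Lemma quadrature_node_side (R : realFieldType) (m k : nat) (lam w : 'I_m -> R)
    (theta d : 'I_k -> R) (sg c : R) :
  (forall i, 0 <= w i) -> (forall j, 0 <= d j) ->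
  (forall p : {poly R}, (size p <= 2 * k)%N ->
     \sum_i w i * p.[lam i] = \sum_j d j * p.[theta j]) ->
  (forall i, 0 <= sg * (c - lam i)) ->
  forall j, 0 < d j -> 0 <= sg * (c - theta j).
Proof.
move=> w0 d0 dp lamc j dj; rewrite leNgt; apply/negP => thc.
(* Nodes may coincide, so the factors are selected by value and not by index. At least the index [j]
   is left out: [Q] has degree at most [k - 1] and [p] at most [2k - 1]. *)
pose Q : {poly R} := \prod_(i | theta i != theta j) ('X - (theta i)%:P).
pose p : {poly R} := sg *: (c%:P - 'X) * Q ^+ 2.
have szQ : (size Q <= k)%N.
  rewrite /Q size_prod; last by move=> i _; rewrite polyXsubC_eq0.
  under eq_bigr do rewrite size_XsubC.
  rewrite sum_nat_const muln2 -addnn -addSn addnK.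
  rewrite -[X in (_ <= X)%N]card_ord -(cardC (fun i : 'I_k => theta i != theta j)).
  rewrite -[X in (X < _)%N]addn0 ltn_add2l; apply/card_gt0P; by exists j; rewrite unfold_in/= unfold_in/= eqxx.
have szp : (size p <= 2 * k)%N.
  rewrite (leq_trans (size_polyMleq _ _))//.
  have : (size (sg *: (c%:P - 'X)) <= 2)%N.
    rewrite (leq_trans (size_scale_leq _ _))// (leq_trans (size_polyD _ _))//.
    by rewrite size_polyN size_polyX geq_max (leq_trans (size_polyC_leq1 _)).
  have : (size (Q ^+ 2) <= (k.-1 * 2).+1)%N.
    by rewrite (leq_trans (size_poly_exp_leq _ _))// ltnS leq_mul2r -!subn1 leq_sub2r.
  have : (0 < k)%N by case: (k) j {dj thc Q p szQ} => // -[].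
  lia.
have pE x : p.[x] = sg * (c - x) * Q.[x] ^+ 2 by rewrite !hornerE.
have Qj : Q.[theta j] != 0.
  rewrite horner_prod; apply/prodf_neq0 => i ij.
  by rewrite !hornerE subr_eq0 eq_sym.
(* The integral of [p] against the measure is nonnegative, while in the rule only nodes equal to
   [theta j] contribute, and they contribute a negative amount. *)
have := dp p szp; apply/eqP; rewrite gt_eqF//.
apply: (@lt_le_trans _ _ 0); last first.
  by apply: sumr_ge0 => i _; rewrite pE mulr_ge0// mulr_ge0// sqr_ge0.
rewrite (bigD1 j)//= ltr_wnDr//.
  rewrite sumr_le0 // => i _; rewrite mulr_ge0_le0// pE.
  have [->|ij] := eqVneq (theta i) (theta j).
    by rewrite mulr_le0_ge0 ?sqr_ge0// ltW.
  suff -> : Q.[theta i] = 0 by rewrite expr0n mulr0.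
  by rewrite horner_prod (bigD1 i)//= !hornerE subrr mul0r.
by rewrite pE pmulr_rlt0// nmulr_rlt0// exprn_even_gt0.
Qed.

Lemma bounded_integrable (d : measure_display) (T : measurableType d) (R : realType)
    (mu : {measure set T -> \bar R}) (D : set T) (f : T -> R) (M : R) :
  measurable D -> (mu D < +oo)%E -> measurable_fun D f ->
  (forall x, D x -> `|f x| <= M) -> mu.-integrable D (EFin \o f).
Proof.
move=> mD muD mf fM; apply: measurable_bounded_integrable => //.
exists M; split; first exact: num_real.
by move=> y My x Dx; apply: (le_trans (fM x Dx)); exact: ltW.
Qed.

Lemma Rintegral_sum (d : measure_display) (T : measurableType d) (R : realType)
    (mu : {measure set T -> \bar R}) (D : set T) (I : Type) (s : seq I) (p : pred I)
    (f : I -> T -> R) : measurable D ->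
  (forall i, mu.-integrable D (EFin \o f i)) ->
  (\int[mu]_(x in D) \sum_(i <- s | p i) f i x = \sum_(i <- s | p i) \int[mu]_(x in D) f i x)%R.
Proof.
move=> mD fi; elim: s => [|i s IHs].
  under eq_Rintegral do rewrite big_nil.
  by rewrite Rintegral_cst// mul0r big_nil.
rewrite big_cons -IHs; case: ifPn => pi; last first.
  by under eq_Rintegral do rewrite big_cons (negbTE pi).
under eq_Rintegral do rewrite big_cons pi.
rewrite RintegralD//.
rewrite (_ : EFin \o _ = fun x => (\sum_(j <- s | p j) (f j x)%:E)%E).
  by apply: integrable_sum => // j _; exact: fi.
by apply/funext => x; rewrite /= sumEFin.
Qed.

(** * Jackson's theorem for Lipschitz functions *)

Lemma cosB (R : realType) (x y : R) : cos (x - y) = cos x * cos y + sin x * sin y.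
Proof. by rewrite cosD cosN sinN mulrN opprK. Qed.

(** These are the Chebyshev polynomials. Their recurrence has order two, so the induction carries
    two consecutive ones. *)
Lemma cos_mul_poly (R : realType) (m : nat) :
  exists p : {poly R}, (size p <= m.+1)%N /\
    forall x, p.[cos x] = cos (m%:R * x).
Proof.
suff [_ //] : (exists p : {poly R}, (size p <= m.+2)%N /\
      forall x, p.[cos x] = cos (m.+1%:R * x)) /\
  exists p : {poly R}, (size p <= m.+1)%N /\ forall x, p.[cos x] = cos (m%:R * x).
elim: m => [|m [[p [szp pE]] [q [szq qE]]]].
  split; [exists 'X|exists 1]; split; rewrite ?size_polyX ?size_poly1// => x.
    by rewrite hornerX mul1r.
  by rewrite hornerC mul0r cos0.
split; last by exists p.
exists ('X * p *+ 2 - q); split.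
  rewrite (leq_trans (size_polyD _ _))// geq_max size_polyN.
  rewrite (leq_trans szq) ?andbT; last by lia.
  rewrite mulr2n (leq_trans (size_polyD _ _))// geq_max andbb.
  by rewrite (leq_trans (size_polyMleq _ _))// size_polyX.
move=> x; rewrite !hornerE pE qE.
have -> : m.+2%:R * x = m.+1%:R * x + x by rewrite -[m.+2]addn1 natrD; ring.
have -> : m%:R * x = m.+1%:R * x - x by rewrite -[m.+1]addn1 natrD; ring.
by rewrite cosB cosD; ring.
Qed.

Lemma sin_add_2pi_natmul (R : realType) (x : R) (m : nat) :
  sin (x + 2 * pi * m%:R) = sin x.
Proof.
elim: m => [|m IHm]; first by rewrite mulr0 addr0.
rewrite -[m.+1]addn1 natrD mulrDr mulr1 addrA -[RHS]IHm.
have -> : x + 2 * pi * m%:R + 2 * pi = x + 2 * pi * m%:R + pi + pi by ring.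
by rewrite !sinDpi opprK.
Qed.

(** Discrete orthogonality, used in place of integrals over a period. Multiplied by the sine of half
    the step, the sum telescopes over a whole number of periods; that sine is nonzero because
    [0 < m < N] puts [b] strictly between [0] and [pi]. *)
Lemma sum_cos_equispaced (R : realType) (N m : nat) (x : R) : (0 < m < N)%N ->
  \sum_(l < N) cos (m%:R * (x + 2 * pi * l%:R / N%:R)) = 0.
Proof.
move=> /andP[m0 mN].
have N0 : 0 < N%:R :> R by rewrite ltr0n (leq_trans _ mN).
pose b : R := pi * m%:R / N%:R.
have sb : sin b != 0.
  rewrite gt_eqF// sin_gt0_pi// /b; apply/andP; split.
    by rewrite divr_gt0// mulr_gt0 ?pi_gt0// ltr0n.
  by rewrite ltr_pdivrMr// ltr_pM2l ?pi_gt0// ltr_nat.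
apply: (mulfI sb); rewrite mulr0 mulr_sumr.
pose g (l : nat) : R := sin (m%:R * x - b + 2 * b * l%:R) / 2.
rewrite (eq_bigr (fun l : 'I_N => g l.+1 - g l)); last first.
  move=> l _; rewrite /g.
  have -> : m%:R * (x + 2 * pi * l%:R / N%:R) = m%:R * x + 2 * b * l%:R.
    by rewrite /b; field; rewrite gt_eqF.
  have -> : m%:R * x - b + 2 * b * l.+1%:R = m%:R * x + 2 * b * l%:R + b.
    by rewrite -[l.+1]addn1 natrD; ring.
  have -> : m%:R * x - b + 2 * b * l%:R = m%:R * x + 2 * b * l%:R - b by ring.
  by rewrite sinB sinD; field.
rewrite -(big_mkord xpredT (fun l => g l.+1 - g l)) telescope_sumr// /g.
have -> : 2 * b * N%:R = 2 * pi * m%:R by rewrite /b; field; rewrite gt_eqF.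
by rewrite sin_add_2pi_natmul mulr0 addr0 subrr.
Qed.

Section trig_kernel.
Variables (R : realType).
Implicit Types (a : nat -> R) (M N : nat) (u x : R).

(** The squared modulus of [sum_j a_j e^(iju)] in real form: nonnegative by construction, and a
    cosine polynomial of degree less than [M] once expanded. *)
Definition trig_kernel a M u : R :=
  (\sum_(j < M) a j * cos (j%:R * u)) ^+ 2 + (\sum_(j < M) a j * sin (j%:R * u)) ^+ 2.

Lemma trig_kernel_ge0 a M u : 0 <= trig_kernel a M u.
Proof. by rewrite addr_ge0 ?sqr_ge0. Qed.

Lemma trig_kernelE a M u : trig_kernel a M u =
  \sum_(i < M) \sum_(j < M) a i * a j * cos (i%:R * u - j%:R * u).
Proof.
rewrite /trig_kernel !expr2 !big_distrl/= -big_split/=; apply: eq_bigr => i _.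
rewrite !big_distrr/= -big_split/=; apply: eq_bigr => j _.
by rewrite cosB; ring.
Qed.

(** Symmetrization removes the sines in [x], so that the result is a polynomial in [cos x]. *)
Lemma trig_kernel_evenD a M u x :
  trig_kernel a M (u + x) + trig_kernel a M (u - x) =
  2 * \sum_(i < M) \sum_(j < M) a i * a j *
    cos (i%:R * u - j%:R * u) * cos (i%:R * x - j%:R * x).
Proof.
rewrite !trig_kernelE -big_split mulr_sumr/=; apply: eq_bigr => i _.
rewrite -big_split mulr_sumr/=; apply: eq_bigr => j _.
set A := i%:R * u - j%:R * u; set B := i%:R * x - j%:R * x.
have -> : i%:R * (u + x) - j%:R * (u + x) = A + B by rewrite /A /B; ring.
have -> : i%:R * (u - x) - j%:R * (u - x) = A - B by rewrite /A /B; ring.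
by rewrite cosB cosD; ring.
Qed.

(** A discrete Parseval identity: off the diagonal the frequency [|i - j|] lies between [1] and
    [N - 1], so its cosines sum to zero. *)
Lemma sum_trig_kernel_equispaced a M N x : (M <= N)%N ->
  \sum_(l < N) trig_kernel a M (x + 2 * pi * l%:R / N%:R) =
  N%:R * \sum_(j < M) a j ^+ 2.
Proof.
move=> MN; under eq_bigr do rewrite trig_kernelE.
rewrite exchange_big mulr_sumr/=; apply: eq_bigr => i _.
rewrite exchange_big/= (bigD1 i)//= [X in _ + X]big1 ?addr0.
    under eq_bigr do rewrite subrr cos0 mulr1.
  by rewrite sumr_const card_ord -[LHS]mulr_natl expr2.
move=> j ji; rewrite -mulr_sumr; apply/eqP; rewrite mulf_eq0; apply/orP; right.
have [iM jM] : (i < N)%N /\ (j < N)%N by split; apply: leq_trans MN; exact: ltn_ord.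
have [lt_ij|lt_ji|/val_inj e] := ltngtP i j; last by rewrite e eqxx in ji.
- have h : (0 < j - i < N)%N by lia.
  rewrite -[X in _ == X](sum_cos_equispaced x h); apply/eqP/eq_bigr => l _.
  by rewrite natrB 1?ltnW// -cosN; congr cos; ring.
- have h : (0 < i - j < N)%N by lia.
  rewrite -[X in _ == X](sum_cos_equispaced x h); apply/eqP/eq_bigr => l _.
  by rewrite natrB 1?ltnW//; congr cos; ring.
Qed.

(* Multiplication by [2 - 2 cos u = |1 - e^{iu}|^2] differentiates the coefficients. *)
Lemma trig_kernel_diff a M u : a M = 0 ->
  (2 - 2 * cos u) * trig_kernel a M u =
  trig_kernel (fun j => a j - (if j is j'.+1 then a j' else 0)) M.+1 u.
Proof.
move=> aM; rewrite /trig_kernel.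
set Cs := \sum_(j < M) a j * cos _; set Sn := \sum_(j < M) a j * sin _.
under [\sum_(j < M.+1) _ * cos _]eq_bigr do rewrite mulrBl.
under [\sum_(j < M.+1) _ * sin _]eq_bigr do rewrite mulrBl.
rewrite !sumrB !big_ord_recr/= aM !mul0r !addr0 -/Cs -/Sn.
have -> : \sum_(i < M) (if i : nat is j'.+1 then a j' else 0) * cos (i%:R * u)
  + (if M is j'.+1 then a j' else 0) * cos (M%:R * u) = Cs * cos u - Sn * sin u.
  rewrite -(big_ord_recr M (fun i => (if i : nat is j'.+1 then a j' else 0)
    * cos (i%:R * u)))/= big_ord_recl/= mul0r add0r.
  rewrite /Cs /Sn !mulr_suml -sumrB; apply: eq_bigr => j _.
  rewrite /bump/= add1n -[j.+1]addn1 natrD mulrDl mul1r cosD; ring.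
have -> : \sum_(i < M) (if i : nat is j'.+1 then a j' else 0) * sin (i%:R * u)
  + (if M is j'.+1 then a j' else 0) * sin (M%:R * u) = Sn * cos u + Cs * sin u.
  rewrite -(big_ord_recr M (fun i => (if i : nat is j'.+1 then a j' else 0)
    * sin (i%:R * u)))/= big_ord_recl/= mul0r add0r.
  rewrite /Cs /Sn !mulr_suml -big_split/=; apply: eq_bigr => j _.
  rewrite /bump/= add1n -[j.+1]addn1 natrD mulrDl mul1r sinD; ring.
have := cos2Dsin2 u; move: (cos u) (sin u) => c s h.
have -> : 2 - 2 * c = (1 - c) ^+ 2 + s ^+ 2.
  by transitivity (1 - 2 * c + (c ^+ 2 + s ^+ 2)); [rewrite h; ring|ring].
by ring.
Qed.

End trig_kernel.

Section jackson.
Variables (R : realType) (k : nat).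
Hypothesis k_gt0 : (0 < k)%N.

(** The coefficients [1, ..., k, k, ..., 1] are the convolution of runs of [k] and [k + 1] ones, so
    the kernel is of Jackson type. Their squares sum to order [k^3] and their squared differences
    only to order [k]; the ratio is the mean of [2 - 2 cos u] under the kernel, of order [k^-2]. The
    vanishing of [a (2 * k)] is what [trig_kernel_diff] requires. *)
Let a (j : nat) : R := (minn j.+1 (2 * k - j))%:R.

Let sum_a2 : k%:R ^+ 3 / 3 <= \sum_(j < 2 * k) a j ^+ 2.
Proof.
have -> : (2 * k = k + k)%N by lia.
rewrite big_split_ord/= ler_wpDr ?sumr_ge0// => [i _|]; first exact: sqr_ge0.
rewrite (eq_bigr (fun j : 'I_k => j.+1%:R ^+ 2)); last first.
  by move=> j _; rewrite /a (minn_idPl _)//; have := ltn_ord j; lia.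
elim: k => [|m IHm]; first by rewrite big_ord0 expr0n mul0r.
rewrite big_ord_recr/= -[m.+1]addn1 natrD; move: IHm.
have : 0 <= m%:R :> R by []; nra.
Qed.

Let sum_da2 :
  \sum_(j < (2 * k).+1) (a j - (if j : nat is j'.+1 then a j' else 0)) ^+ 2 <= 3 * k%:R.
Proof.
have h (j : nat) : (a j - (if j is j'.+1 then a j' else 0)) ^+ 2 <= 1.
  rewrite -[X in X <= _]real_normK ?num_real// expr_le1// /a; case: j => [|j].
    by rewrite subr0 normr_nat lern1; lia.
  set A := minn _ _; set B := minn _ _.
  have : (A%:R <= B%:R + 1 :> R) by rewrite natr1 ler_nat /A /B; lia.
  have : (B%:R <= A%:R + 1 :> R) by rewrite natr1 ler_nat /A /B; lia.
  by rewrite ler_norml => *; apply/andP; split; lra.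
apply: (@le_trans _ _ (\sum_(j < (2 * k).+1) 1)); first by apply: ler_sum => j _.
by rewrite sumr_const card_ord -natrM ler_nat; lia.
Qed.

(** By the arithmetic-geometric inequality [d <= (d^2 / e + e) / 2], where [d^2 <= 2 - 2 cos u]
    because [f] is 1-Lipschitz, the first moment of the kernel is bounded by its second, which
    [trig_kernel_diff] evaluates. The choice [e = 3 / k] is the square root of the ratio
    [3 k / (k^3 / 3)] of the two bounds above. The differenced kernel has [2k + 1] coefficients,
    which explains the [N = 2k + 1] sample points. *)
Let kernel_error (f : R -> R) (x : R) (N := (2 * k).+1) (s := (\sum_(j < 2 * k) a j ^+ 2)) :
  (forall y z : R, -1 <= y <= 1 -> -1 <= z <= 1 -> `|f y - f z| <= `|y - z|) ->
  \sum_(l < N) `|f (cos x) - f (cos (2 * pi * l%:R / N%:R))| *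
    trig_kernel a (2 * k) (x + 2 * pi * l%:R / N%:R) <= (N%:R * s) * (3 / k%:R).
Proof.
move=> lipf; have k0 : 0 < k%:R :> R by rewrite ltr0n.
pose e : R := 3 / k%:R; have e0 : 0 < e by rewrite divr_gt0.
have cosI (y : R) : -1 <= cos y <= 1 by rewrite cos_geN1 cos_le1.
pose u (l : nat) : R := x + 2 * pi * l%:R / N%:R.
have amgm (l : nat) : `|f (cos x) - f (cos (2 * pi * l%:R / N%:R))| <=
    2^-1 * (e^-1 * (2 - 2 * cos (u l)) + e).
  set d := `|_|; have d0 : 0 <= d by exact: normr_ge0.
  have : d ^+ 2 <= 2 - 2 * cos (u l).
    apply: (@le_trans _ _ (`|cos x - cos (2 * pi * l%:R / N%:R)| ^+ 2)).
      by rewrite ler_sqr ?nnegrE// lipf.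
    rewrite real_normK ?num_real// /u cosD; set y := _ / N%:R.
    have := cos2Dsin2 x; have := cos2Dsin2 y.
    have : 0 <= (sin x + sin y) ^+ 2 by exact: sqr_ge0.
    by move: (cos x) (sin x) (cos y) (sin y) => *; nra.
  move=> h; have : e^-1 * d ^+ 2 <= e^-1 * (2 - 2 * cos (u l)).
    by rewrite ler_pM2l ?invr_gt0.
  have : 0 <= e^-1 * (d - e) ^+ 2 by rewrite mulr_ge0 ?sqr_ge0// invr_ge0 ltW.
  have -> : e^-1 * (d - e) ^+ 2 = e^-1 * d ^+ 2 - 2 * d + e by field; rewrite gt_eqF.
  by lra.
apply: (@le_trans _ _ (\sum_(l < N) (2^-1 * (e^-1 *
   ((2 - 2 * cos (u l)) * trig_kernel a (2 * k) (u l)) + e * trig_kernel a (2 * k) (u l))))).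
  apply: ler_sum => l _.
  have := ler_wpM2r (trig_kernel_ge0 a (2 * k) (u l)) (amgm l).
  by move=> /le_trans; apply; rewrite le_eqVlt; apply/orP; left; apply/eqP; ring.
rewrite -mulr_sumr big_split/= -!mulr_sumr.
under eq_bigr do rewrite trig_kernel_diff ?/a ?subnn ?minn0//.
rewrite !sum_trig_kernel_equispaced// -/s -/e.
have N0 : 0 <= N%:R :> R by [].
set V := \sum_(j < _) _.
have Vs : e^-1 * V <= e * s.
  apply: (@le_trans _ _ (e^-1 * (3 * k%:R))).
    by rewrite ler_pM2l ?invr_gt0// sum_da2.
  apply: (@le_trans _ _ (e * (k%:R ^+ 3 / 3))); last by rewrite ler_pM2l// sum_a2.
  by rewrite /e le_eqVlt; apply/orP; left; apply/eqP; field; rewrite gt_eqF.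
have := ler_wpM2l N0 Vs; lra.
Qed.

(** The polynomial is the discrete convolution of [f \o cos] with the symmetrized, normalized
    kernel. Its frequencies [|i - j|] are at most [2k - 1], and Chebyshev polynomials turn them into
    powers of [y = cos t]. *)
Lemma jackson_unit (f : R -> R) :
  (forall y z : R, -1 <= y <= 1 -> -1 <= z <= 1 -> `|f y - f z| <= `|y - z|) ->
  exists2 p : {poly R}, (size p <= 2 * k)%N &
    forall y, -1 <= y <= 1 -> `|f y - p.[y]| <= 3 / k%:R.
Proof.
move=> lipf; have k0 : 0 < k%:R :> R by rewrite ltr0n.
set N := (2 * k).+1; pose s : R := \sum_(j < 2 * k) a j ^+ 2.
have s0 : 0 < s by apply: lt_le_trans sum_a2; rewrite divr_gt0// exprn_gt0.
pose x (l : nat) : R := 2 * pi * l%:R / N%:R.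
have /choice[q qE] := @cos_mul_poly R.
pose dist (i j : nat) := ((i - j) + (j - i))%N.
have cos_dist i j y : cos (i%:R * y - j%:R * y) = cos ((dist i j)%:R * y) :> R.
  rewrite /dist; case: (leqP i j) => ij.
    rewrite (eqP ij) add0n natrB// -cosN; congr cos; ring.
  rewrite natrD natrB 1?ltnW// (eqP (ltnW ij)) addr0; congr cos; ring.
pose p : {poly R} := (N%:R * s)^-1 *: \sum_(l < N) (f (cos (x l)) *:
  \sum_(i < 2 * k) \sum_(j < 2 * k)
    (a i * a j * cos (i%:R * x l - j%:R * x l)) *: q (dist i j)).
exists p.
  rewrite (leq_trans (size_scale_leq _ _))//.
  rewrite (leq_trans (size_sum _ _ _))//; apply/bigmax_leqP => l _; rewrite (leq_trans (size_scale_leq _ _))//.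
  rewrite (leq_trans (size_sum _ _ _))//; apply/bigmax_leqP => i _; rewrite (leq_trans (size_sum _ _ _))//; apply/bigmax_leqP => j _.
  rewrite (leq_trans (size_scale_leq _ _))// (leq_trans (qE _).1)//.
  by rewrite /dist; have := ltn_ord i; have := ltn_ord j; lia.
move=> y yI; have [t yE] : exists t, y = cos t by exists (acos y); rewrite acosK.
have Ns0 : 0 < N%:R * s by rewrite mulr_gt0// ltr0n.
have pE : p.[y] = (N%:R * s)^-1 * \sum_(l < N) (f (cos (x l)) *
    ((trig_kernel a (2 * k) (t + x l) + trig_kernel a (2 * k) (- t + x l)) / 2)).
  rewrite /p hornerZ horner_sum; congr (_ * _); apply: eq_bigr => l _.
  rewrite hornerZ; congr (_ * _); rewrite horner_sum.
  rewrite [t + _]addrC [- t + _]addrC trig_kernel_evenD mulrAC divff// mul1r.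
  apply: eq_bigr => i _; rewrite horner_sum; apply: eq_bigr => j _.
  by rewrite hornerZ yE (qE _).2 [cos (_ * t - _)]cos_dist.
(* The weights sum to [1], so [f y] can be moved under the same average as [p]. *)
have fE : f y = (N%:R * s)^-1 * \sum_(l < N) (f y *
    ((trig_kernel a (2 * k) (t + x l) + trig_kernel a (2 * k) (- t + x l)) / 2)).
  rewrite -mulr_sumr -mulr_suml big_split/= /x !sum_trig_kernel_equispaced//.
  by rewrite -/s; field; rewrite gt_eqF //= gt_eqF// ltr0n.
rewrite [X in X - _]fE pE -mulrBr -sumrB normrM gtr0_norm ?invr_gt0// mulrC ler_pdivrMr//.
rewrite (le_trans (ler_norm_sum _ _ _))//.
have e1 := kernel_error t lipf; have e2 := kernel_error (- t) lipf.
rewrite cosN in e2; rewrite -yE -/N -/s in e1 e2.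
have := lerD e1 e2; rewrite -big_split/= => e12.
rewrite -(ler_pM2l (ltr0Sn R 1)) mulr_sumr; apply: le_trans (le_trans _ e12) _; last first.
  by rewrite le_eqVlt; apply/orP; left; apply/eqP; ring.
apply: ler_sum => l _; rewrite -mulrBl normrM -/(x l).
rewrite [X in _ * (_ * X)]ger0_norm ?divr_ge0 ?addr_ge0 ?sqr_ge0//.
by rewrite le_eqVlt; apply/orP; left; apply/eqP; field.
Qed.

End jackson.

Lemma jackson (R : realType) (k : nat) (f : R -> R) (a b : R) : (0 < k)%N -> a <= b ->
  (forall y z : R, a <= y <= b -> a <= z <= b -> `|f y - f z| <= `|y - z|) ->
  exists2 p : {poly R}, (size p <= 2 * k)%N &
    forall y, a <= y <= b -> `|f y - p.[y]| <= (b - a) / 2 * (3 / k%:R).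
Proof.
move=> k_gt0; rewrite le_eqVlt => /predU1P[<- _|ab lipf].
  exists (f a)%:P => [|y /le_anti <-].
    by rewrite (leq_trans (size_polyC_leq1 _))//; lia.
  by rewrite hornerC !subrr normr0 mul0r mul0r.
pose h := (b - a) / 2; have h0 : 0 < h by rewrite /h; lra.
pose c := (a + b) / 2.
have [|q szq qE] := jackson_unit k_gt0 (f := fun y => f (c + h * y) / h).
  move=> y z yI zI; rewrite -mulrBl normrM normfV [X in _ / X]gtr0_norm//.
  rewrite ler_pdivrMr//.
  have -> : `|y - z| * h = `|(c + h * y) - (c + h * z)|.
    by rewrite -[in LHS](gtr0_norm h0) -normrM; congr (`|_|); ring.
  by apply: lipf; rewrite /c /h; apply/andP; split; nra.
exists (h *: (q \Po (h^-1 *: ('X - c%:P)))).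
  rewrite (leq_trans (size_scale_leq _ _))//.
  have [-> |q0] := eqVneq q 0; first by rewrite comp_poly0 size_poly0.
  rewrite size_comp_poly2// size_scale ?size_XsubC// invr_eq0 gt_eqF//.
move=> y yI; rewrite hornerZ horner_comp hornerZ hornerXsubC.
set z := h^-1 * (y - c).
have zE : c + h * z = y by rewrite /z; field; rewrite gt_eqF.
have zI : -1 <= z <= 1 by rewrite -zE /c /h in yI *; apply/andP; split; nra.
have -> : f y - h * q.[z] = h * (f y / h - q.[z]) by field; rewrite gt_eqF.
by rewrite normrM [`|h|]gtr0_norm// -/h ler_pM2l// -[in f y]zE qE.
Qed.

(** * Wasserstein error of Gaussian quadrature *)

Lemma measurable_indic_le (R : realType) (y : R) :
  measurable_fun [set: R] (indic_le y).
Proof. by apply: measurable_fun_ifT => //; exact: measurable_fun_ler. Qed.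

Lemma measurable_step_cdf (R : realType) (m : nat) (th d : 'I_m -> R) :
  measurable_fun [set: R] (step_cdf th d).
Proof.
apply: measurable_sum => j; apply: measurable_funM => //.
exact: measurable_indic_le.
Qed.

Section dW_quadrature.
Variables (R : realType) (m k : nat) (lam w : 'I_m -> R) (theta d : 'I_k -> R).
Variables (a b : R).
Hypothesis k_gt0 : (0 < k)%N.
Hypothesis ab : a <= b.
Hypothesis w_ge0 : forall i, 0 <= w i.
Hypothesis w_sum : \sum_i w i = 1.
Hypothesis d_ge0 : forall j, 0 <= d j.
Hypothesis lamI : forall i, a <= lam i <= b.
Hypothesis exact_rule : forall p : {poly R}, (size p <= 2 * k)%N ->
  \sum_i w i * p.[lam i] = \sum_j d j * p.[theta j].

Let leb := @lebesgue_measure R.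

(** A node without mass may lie anywhere, but it drops out of every sum below. *)
Let thetaI j : d j = 0 \/ a <= theta j <= b.
Proof.
have := d_ge0 j; rewrite le_eqVlt => /predU1P[<-|dj]; first by left.
right; apply/andP; split.
  have := quadrature_node_side (sg := -1) (c := a) w_ge0 d_ge0 exact_rule _ dj.
  by rewrite mulN1r opprB subr_ge0; apply=> i; rewrite mulN1r opprB subr_ge0; case/andP: (lamI i).
have := quadrature_node_side (sg := 1) (c := b) w_ge0 d_ge0 exact_rule _ dj.
by rewrite mul1r subr_ge0; apply=> i; rewrite mul1r subr_ge0; case/andP: (lamI i).
Qed.

Let d_sum : \sum_j d j = 1.
Proof.
rewrite -w_sum; have := @exact_rule 1; rewrite size_poly1 => /(_ _)/esym.
under eq_bigr do rewrite hornerC mulr1.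
by under [X in _ = X]eq_bigr do rewrite hornerC mulr1; apply; lia.
Qed.

Let F x := step_cdf lam w x - step_cdf theta d x.

(** To the left of the interval both functions are [0], to the right both are the common total mass
    [1]; the distance is thus an integral over [[a, b]]. *)
Let F_out x : ~ `[a, b]%classic x -> F x = 0.
Proof.
move=> xab; have : (x < a) || (b < x).
  by rewrite !ltNge -negb_and; apply/negP => xI; apply: xab; rewrite /= in_itv.
rewrite /F /step_cdf => /orP[xa|bx].
  rewrite !big1 ?subrr// => [j _|i _]; rewrite /indic_le.
    case: (thetaI j) => [->|/andP[/(lt_le_trans xa)]]; first by rewrite mul0r.
    by rewrite ltNge => /negbTE -> _; rewrite mulr0.
  by case/andP: (lamI i) => /(lt_le_trans xa); rewrite ltNge => /negbTE -> _; rewrite mulr0.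
rewrite -[X in _ = X](subrr (1 : R)) -[X in _ = X - _]w_sum -[X in _ = _ - X]d_sum.
congr (_ - _); apply: eq_bigr => j _; rewrite /indic_le.
  by case/andP: (lamI j) => _ /le_trans/(_ (ltW bx)) ->; rewrite mulr1.
case: (thetaI j) => [->|/andP[_ /le_trans/(_ (ltW bx)) ->]]; first by rewrite mul0r.
by rewrite mulr1.
Qed.

Let mF : measurable_fun [set: R] F.
Proof. by apply: measurable_funB; exact: measurable_step_cdf. Qed.

Let s x : R := if 0 <= F x then 1 else -1.

Let ms : measurable_fun [set: R] s.
Proof. by apply: measurable_fun_ifT => //; apply: measurable_fun_ler. Qed.

Let s1 x : `|s x| <= 1.
Proof. by rewrite /s; case: ifP => _; rewrite ?normrN normr1. Qed.

Let leb_fin : (leb `[a, b] < +oo)%E.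
Proof. by rewrite /leb lebesgue_measure_itv/=; case: ifP => _; rewrite ?ltry. Qed.

(* [int |F| = int p0 d(mu - nu)] for the 1-Lipschitz primitive [p0] of [-sgn F] *)
Let p0 y := (\int[leb]_(x in `[a, b]) (s x * indic_le y x))%R.

Let is_int y : leb.-integrable `[a, b] (EFin \o (fun x => s x * indic_le y x)).
Proof.
apply: (@bounded_integrable _ _ _ _ _ _ 1) => //=.
  apply: measurable_funTS; apply: measurable_funM => //; exact: measurable_indic_le.
move=> x _; rewrite normrM -[X in _ <= X]mulr1 ler_pM// /indic_le.
by case: ifP => _; rewrite ?normr1 ?normr0.
Qed.

Let p0_lip y z : a <= y <= b -> a <= z <= b -> `|p0 y - p0 z| <= `|y - z|.
Proof.
wlog yz : y z / y <= z => [wlg|] yI zI.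
  have [|/ltW] := leP y z; first by move=> yz; exact: wlg.
  by rewrite distrC [`|y - z|]distrC => zy; exact: wlg.
rewrite /p0 -RintegralB//.
under eq_Rintegral do rewrite -mulrBr.
have mi : measurable_fun `[a, b] (fun x => indic_le y x - indic_le z x).
  by apply: measurable_funTS; apply: measurable_funB; exact: measurable_indic_le.
have iE x : indic_le y x - indic_le z x = \1_`[y, z[ x.
  rewrite /indic_le indicE mem_setE in_itv/= [x < z]ltNge.
  case: (leP z x) => [zx|xz]; first by rewrite (le_trans yz zx) subrr.
  by case: (leP y x); rewrite subr0.
have i1 : leb.-integrable `[a, b] (EFin \o (fun x => indic_le y x - indic_le z x)).
  apply: (@bounded_integrable _ _ _ _ _ _ 1) => //= x _.
  by rewrite iE ger0_norm// indicE; case: (_ \in _).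
have i2 : leb.-integrable `[a, b] (EFin \o (fun x => s x * (indic_le y x - indic_le z x))).
  apply: (@bounded_integrable _ _ _ _ _ _ 1) => //=.
    by apply: measurable_funM => //; exact: measurable_funTS.
  by move=> x _; rewrite normrM -[X in _ <= X]mulr1 ler_pM// iE ger0_norm.
rewrite (le_trans (le_normr_Rintegral _ i2))//.
apply: (@le_trans _ _ (\int[leb]_(x in `[a, b]) (indic_le y x - indic_le z x))%R).
  apply: le_Rintegral => //.
    by have := integrable_abse i2; apply: eq_integrable.
  move=> x _; rewrite normrM iE [X in _ * X]ger0_norm// -[X in _ <= X]mul1r.
  by rewrite ler_wpM2r.
under eq_Rintegral do rewrite iE.
rewrite /Rintegral integral_indic//.
have -> : `[y, z[%classic `&` `[a, b] = `[y, z[%classic.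
  apply/setIidl => x /=; rewrite !in_itv/= => /andP[yx xz].
  by case/andP: yI => ay _; case/andP: zI => _ zb; apply/andP; split; lra.
rewrite /leb /= lebesgue_measure_itv/= lte_fin; case: ifP => [_|] /=.
  by rewrite distrC ger0_norm ?subr_ge0.
by rewrite normr_ge0.
Qed.

(** Writing [|F| = s F] and exchanging sum and integral gives the difference of the two integrals of
    [p0]. Both measures integrate the Jackson polynomial [q] to the same value, so replacing [p0] by
    [q] costs [e] per measure, each of mass [1]. *)
Lemma dW_quadrature_le :
  (dW (step_cdf lam w) (step_cdf theta d) <= ((b - a) * (3 / k%:R))%:E)%E.
Proof.
have FE : (dW (step_cdf lam w) (step_cdf theta d) =
    \int[leb]_(x in `[a, b]) (`|F x|)%:E)%E.
  rewrite [RHS]integral_mkcond; apply: eq_integral => x _.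
  rewrite patchE; case: ifPn => //; rewrite notin_setE => /F_out.
  by rewrite /F => ->; rewrite normr0.
have FM x : `|F x| <= \sum_i w i + \sum_j d j.
  rewrite /F (le_trans (ler_normB _ _))// lerD// (le_trans (ler_norm_sum _ _ _))//;
    apply: ler_sum => i _; rewrite normrM ger0_norm// -[X in _ <= X]mulr1 ler_wpM2l// /indic_le;
    by case: ifP => _; rewrite ?normr1 ?normr0.
have Fint : leb.-integrable `[a, b] (EFin \o (fun x => `|F x|)).
  apply: (bounded_integrable (M := \sum_i w i + \sum_j d j)) => //=.
    by apply: measurable_funTS; apply: measurableT_comp.
  by move=> x _; rewrite normr_id.
rewrite FE -(fineK (integrable_fin_num _ Fint))// lee_fin -/(Rintegral _ _ _).
have -> : (\int[leb]_(x in `[a, b]) `|F x|)%R =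
    \sum_i w i * p0 (lam i) - \sum_j d j * p0 (theta j).
  rewrite (@eq_Rintegral _ _ _ leb _ (fun x => \sum_i w i * (s x * indic_le (lam i) x)
      - \sum_j d j * (s x * indic_le (theta j) x))); last first.
    move=> x _; have -> : `|F x| = s x * F x.
      by rewrite /s; case: ifPn => [/ger0_norm ->|]; rewrite ?mul1r// mulN1r -ltNge => /ltr0_norm.
    rewrite /F /step_cdf mulrBr !mulr_sumr; congr (_ - _); apply: eq_bigr => i _; ring.
  have zi c y : leb.-integrable `[a, b] (EFin \o (fun x => c * (s x * indic_le y x))).
    exact: (integrableZl _ c (is_int y)).
  have si (I : finType) (c y : I -> R) : leb.-integrable `[a, b]
      (EFin \o (fun x => \sum_i c i * (s x * indic_le (y i) x))).
    rewrite (_ : EFin \o _ = fun x => (\sum_i (c i * (s x * indic_le (y i) x))%:E)%E).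
      by apply: integrable_sum => // i _; exact: zi.
    by apply/funext => x; rewrite /= sumEFin.
  rewrite RintegralB// !Rintegral_sum//.
  by congr (_ - _); apply: eq_bigr => i _; rewrite RintegralZl.
have [q szq qE] := jackson k_gt0 ab p0_lip.
pose e := (b - a) / 2 * (3 / k%:R).
have -> : (b - a) * (3 / k%:R) = e * 1 + e * 1 by rewrite /e; field; rewrite gt_eqF// ltr0n.
rewrite -[X in _ <= e * X + _]w_sum -[X in _ <= _ + e * X]d_sum !mulr_sumr.
rewrite -[X in X - _](subrK (\sum_i w i * q.[lam i])) -addrA lerD//.
  rewrite -sumrB; apply: ler_sum => i _; rewrite -mulrBr mulrC ler_wpM2r//.
  by rewrite (le_trans (ler_norm _))// qE.
rewrite exact_rule// -sumrB; apply: ler_sum => j _; rewrite -mulrBr mulrC.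
case: (thetaI j) => [->|tI]; first by rewrite !mulr0.
by rewrite ler_wpM2r// (le_trans (ler_norm _))// distrC qE.
Qed.

End dW_quadrature.

(** * Derivatives and integrals *)

Section derivation_rules.
Variables (R : realType).
Implicit Types (f g : R -> R) (x a b : R).

(** Lets the differentiation rules produce the derivative in whatever shape they yield, to be
    compared afterwards with the expected value. *)
Lemma is_derive_value f x a b : is_derive x 1 f a -> a = b -> is_derive x 1 f b.
Proof. by move=> fa <-. Qed.

Lemma is_derive_pointwiseD f g x a b : is_derive x 1 f a -> is_derive x 1 g b ->
  is_derive x 1 (fun y => f y + g y) (a + b).
Proof. exact: is_deriveD. Qed.

Lemma is_derive_pointwiseM f g x a b : is_derive x 1 f a -> is_derive x 1 g b ->
  is_derive x 1 (fun y => f y * g y) (a * g x + f x * b).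
Proof.
move=> fa gb; have := is_deriveM fa gb.
by rewrite /GRing.scale/= addrC [g x * _]mulrC.
Qed.

Lemma is_derive_pointwiseZ f x a b : is_derive x 1 f a ->
  is_derive x 1 (fun y => b * f y) (b * a).
Proof.
move=> fa; have := is_derive_pointwiseM (is_derive_cst b x 1) fa.
by rewrite mul0r add0r.
Qed.

Lemma is_derive_pointwiseX f x a (n : nat) : is_derive x 1 f a ->
  is_derive x 1 (fun y => f y ^+ n) (n%:R * f x ^+ n.-1 * a).
Proof. by move=> fa; have := is_deriveX n fa; rewrite exprfctE. Qed.

Lemma is_derive_comp_expR f x a : is_derive x 1 f a ->
  is_derive x 1 (fun y => expR (f y)) (a * expR (f x)).
Proof.
by move=> fa; have := is_derive1_comp (is_derive_expR (f x)) fa; rewrite mulrC.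
Qed.

Lemma le_start_of_derive_le0 (f f' : R -> R) :
  (forall x, is_derive x 1 f (f' x)) -> (forall x, 0 < x -> f' x <= 0) ->
  forall x, 0 <= x -> f x <= f 0.
Proof.
move=> df f'0 x; rewrite le_eqVlt => /predU1P[<-//|x0].
have [|c + e] := MVT (f := f) (df := f') x0 (fun y _ => df y).
  by apply: derivable_within_continuous => y _; have [] := df y.
rewrite in_itv/= => /andP[c0 _]; rewrite -subr_le0 e subr0.
by rewrite mulr_le0_ge0 ?f'0// ltW.
Qed.

End derivation_rules.

Lemma is_derive_Rintegral (d : measure_display) (T : measurableType d) (R : realType)
    (mu : {measure set T -> \bar R}) (D : set T) (g g' : R -> T -> R) (a M : R) :
  measurable D -> (mu D < +oo)%E ->
  (forall x, measurable_fun D (g x)) ->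
  (forall (x : R) y, D y -> is_derive x 1 (g ^~ y) (g' x y)) ->
  (forall x y, a - 1 < x < a + 1 -> D y -> `|g x y| <= M /\ `|g' x y| <= M) ->
  is_derive a 1 (fun x => \int[mu]_(y in D) g x y)%R (\int[mu]_(y in D) g' a y)%R.
Proof.
move=> mD muD mg dg gM.
have Ia : `]a - 1, a + 1[%classic a by rewrite /= in_itv/=; apply/andP; split; lra.
have ig x : `]a - 1, a + 1[%classic x -> mu.-integrable D (EFin \o g x).
  rewrite /= in_itv/= => xI; apply: (bounded_integrable mD muD (mg x)) => y Dy.
  exact: (gM x y xI Dy).1.
have dg' x y : `]a - 1, a + 1[%classic x -> D y -> derivable (g ^~ y) x 1.
  by move=> _ Dy; have [] := dg x y Dy.
have gE x y : D y -> partial1of2 g x y = g' x y.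
  by move=> Dy; rewrite partial1of2E; have [_ ->] := dg x y Dy.
have iM : mu.-integrable D (EFin \o cst `|M|).
  by apply: (bounded_integrable (M := `|M|) mD muD) => // y Dy; rewrite normr_id.
have M0 (y : T) : 0 <= cst `|M| y by exact: normr_ge0.
have bM x y : `]a - 1, a + 1[%classic x -> D y -> `|partial1of2 g x y| <= cst `|M| y.
  rewrite /= in_itv/= => xI Dy; rewrite gE// (le_trans (gM x y xI Dy).2)//.
  exact: ler_norm.
apply: DeriveDef; first exact: (derivable_under_integral mD Ia ig dg' M0 iM bM).
rewrite -derive1E (differentiation_under_integral mD Ia ig dg' M0 iM bM).
by apply: eq_Rintegral => y /set_mem Dy; exact: gE.
Qed.

Lemma eq_law_Rintegral (d d' : measure_display) (X : measurableType d)
    (Y : measurableType d') (R : realType) (mu : {measure set X -> \bar R})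
    (phi psi : X -> Y) (f : Y -> R) :
  measurable_fun [set: X] phi -> measurable_fun [set: X] psi ->
  (forall B, measurable B -> mu (phi @^-1` B) = mu (psi @^-1` B)) ->
  measurable_fun [set: Y] f ->
  mu.-integrable [set: X] (EFin \o (f \o phi)) ->
  mu.-integrable [set: X] (EFin \o (f \o psi)) ->
  (\int[mu]_x f (phi x) = \int[mu]_x f (psi x))%R.
Proof.
move=> mphi mpsi eqlaw mf ifphi ifpsi; congr fine.
have mf' : measurable_fun [set: Y] (EFin \o f) by exact/measurable_EFinP.
have h1 := @integral_pushforward _ _ _ _ _ _ mphi mu setT _ mf' ifphi measurableT.
have h2 := @integral_pushforward _ _ _ _ _ _ mpsi mu setT _ mf' ifpsi measurableT.
rewrite !preimage_setT in h1 h2.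
transitivity (\int[pushforward mu phi]_y (f y)%:E)%E; first by rewrite h1.
transitivity (\int[pushforward mu psi]_y (f y)%:E)%E; last by rewrite h2.
by apply: eq_measure_integral => A mA _; exact: eqlaw.
Qed.

(** * Rotation-invariant vectors on the sphere *)

Lemma sum_sqr_orthogonal (R : comPzRingType) (n : nat) (Q : 'M[R]_n) (x : 'cV[R]_n) :
  Q^T *m Q = 1%:M -> \sum_i ((Q *m x) i 0) ^+ 2 = \sum_i (x i 0) ^+ 2.
Proof.
have sqE (y : 'cV[R]_n) : \sum_i (y i 0) ^+ 2 = (y^T *m y) 0 0.
  by rewrite mxE; apply: eq_bigr => i _; rewrite mxE expr2.
by move=> QQ; rewrite !sqE trmx_mul mulmxA -[_ *m Q^T *m Q]mulmxA QQ mulmx1.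
Qed.

Section plane_rotation.
Variables (R : realType) (n : nat) (i j : 'I_n).
Hypothesis ij : i != j.

Definition plane_rotation (t : R) : 'M[R]_n := \matrix_(p, q)
  (if p == i then cos t *+ (q == i) - sin t *+ (q == j)
   else if p == j then sin t *+ (q == i) + cos t *+ (q == j)
   else (q == p)%:R).

Lemma plane_rotationE t (x : 'cV[R]_n) p : (plane_rotation t *m x) p 0 =
  if p == i then cos t * x i 0 - sin t * x j 0
  else if p == j then sin t * x i 0 + cos t * x j 0 else x p 0.
Proof.
have pick (c : R) r : \sum_q c *+ (q == r) * x q 0 = c * x r 0.
  rewrite (bigD1 r)//= eqxx mulr1n big1 ?addr0// => q /negbTE ->.
  by rewrite mulr0n mul0r.
rewrite mxE; under eq_bigr do rewrite mxE.
case: ifP => _; [|case: ifP => _].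
- by under eq_bigr do rewrite mulrBl; rewrite sumrB !pick.
- by under eq_bigr do rewrite mulrDl; rewrite big_split/= !pick.
- by rewrite pick mul1r.
Qed.

Lemma plane_rotation_orthogonal t : (plane_rotation t)^T *m plane_rotation t = 1%:M.
Proof.
have -> : (plane_rotation t)^T = plane_rotation (- t).
  apply/matrixP => p q; rewrite !mxE cosN sinN.
  have ji : (j == i) = false by rewrite eq_sym (negbTE ij).
  have [->|pi] := eqVneq p i; have [->|qi] := eqVneq q i; rewrite ?eqxx ?(negbTE ij) ?ji.
  - by rewrite !mulr0n !subr0.
  - have [eqj|qj] := eqVneq q j; rewrite ?eqj ?eqxx ?ji ?(negbTE ij) ?mulr1n ?mulr0n; first by ring.
    by rewrite ?mulr0n ?oppr0 ?subr0 ?addr0 ?add0r.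
  - have [ep|pj] := eqVneq p j; rewrite ?ep ?eqxx ?ji ?(negbTE ij) ?mulr1n ?mulr0n; first by ring.
    by rewrite subrr eq_sym (negbTE pi).
  - have [eqj|qj] := eqVneq q j; have [ep|pj] := eqVneq p j; rewrite ?eqj ?ep ?eqxx ?mulr1n ?mulr0n ?ji //.
    + by rewrite ?mulr0n ?addr0 eq_sym (negbTE pj).
    + by rewrite ?mulr0n ?addr0 eq_sym (negbTE qj).
    + by rewrite eq_sym.
have rotK (x : 'cV[R]_n) : plane_rotation (- t) *m (plane_rotation t *m x) = x.
  apply/colP => p; rewrite !plane_rotationE !eqxx (eq_sym j i) (negbTE ij) cosN sinN.
  have := cos2Dsin2 t; move: (cos t) (sin t) => c s cs.
  have [->|pi] := eqVneq p i; first by rewrite -[RHS]mul1r -cs; ring.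
  have [->|//] := eqVneq p j; by rewrite -[RHS]mul1r -cs; ring.
apply/matrixP => p q.
have := congr1 (fun y : 'cV[R]_n => y p 0) (rotK (delta_mx q 0)).
by rewrite mulmxA -colE !mxE eqxx andbT.
Qed.

End plane_rotation.

Lemma col2tupE (R : realType) (n : nat) (c : 'cV[R]_n) i : tnth (col2tup c) i = c i 0.
Proof. by rewrite tnth_mktuple. Qed.

Definition unit_tuples (R : realType) (n : nat) : set (n.-tuple R) :=
  [set x | \sum_i (tnth x i) ^+ 2 = 1].

Lemma measurable_unit_tuples (R : realType) (n : nat) : measurable (@unit_tuples R n).
Proof.
have -> : @unit_tuples R n =
    [set: n.-tuple R] `&` (fun x => \sum_i (tnth x i) ^+ 2) @^-1` [set 1].
  by rewrite setTI.
apply: measurable_sum => // i; apply: measurable_funX; exact: measurable_tnth.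
Qed.

Section spherical.
Variables (R : realType) (n : nat) (d : measure_display) (T : measurableType d).
Variables (P : probability T R) (u : T -> 'cV[R]_n).
Hypothesis mu : random_vector u.
Hypothesis hu : uniform_on_sphere P u.

Lemma measurable_coord i : measurable_fun [set: T] (fun w => u w i 0).
Proof.
have -> : (fun w => u w i 0) = (@tnth n R)^~ i \o (fun w => col2tup (u w)).
  by apply/funext => w /=; rewrite col2tupE.
exact: (iffLR (measurable_fun_tnthP _) mu i).
Qed.

Lemma random_vector_mulmx (Q : 'M[R]_n) : random_vector (fun w => Q *m u w).
Proof.
apply/measurable_fun_tnthP => i.
have -> : (@tnth n R)^~ i \o (fun w => col2tup (Q *m u w)) =
    (fun w => \sum_j Q i j * u w j 0).
  by apply/funext => w /=; rewrite col2tupE mxE.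
by apply: measurable_sum => j; apply: measurable_funM => //; exact: measurable_coord.
Qed.

Lemma uniform_on_sphere_mulmx (Q : 'M[R]_n) : Q^T *m Q = 1%:M ->
  uniform_on_sphere P (fun w => Q *m u w).
Proof.
case: hu => hu1 hu2 QQ; split.
  by rewrite -hu1; congr (P _); apply/funext => w; rewrite /= sum_sqr_orthogonal.
move=> Q' Q'Q' B mB; rewrite -(hu2 Q QQ B mB) (hu2 (Q' *m Q) _ B mB).
  by under eq_fun do rewrite -mulmxA.
by rewrite trmx_mul mulmxA -[_ *m Q'^T *m Q']mulmxA Q'Q' mulmx1.
Qed.

(** Unit norm holds only almost surely; integrating over this event of full measure makes the bounds
    on coordinates hold at every point of the domain. *)
Definition unit_event : set T := [set w | \sum_i (u w i 0) ^+ 2 = 1].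

Lemma measurable_unit_event : measurable unit_event.
Proof.
have -> : unit_event = [set: T] `&` (fun w => \sum_i (u w i 0) ^+ 2) @^-1` [set 1].
  by rewrite setTI.
apply: measurable_sum => // i; apply: measurable_funX; exact: measurable_coord.
Qed.

Lemma probability_unit_event : P unit_event = 1%E.
Proof. by case: hu. Qed.

Local Notation D := unit_event.

Let PDoo : (P D < +oo)%E.
Proof. by rewrite probability_unit_event ltry. Qed.

(** The function is bounded only on the sphere, so it is cut off there before the equality of laws
    is applied; [Q] preserves the norm, so the cut-off event is the same on both sides. *)
Lemma rotation_invariance (g : n.-tuple R -> R) (M : R) (Q : 'M[R]_n) :
  measurable_fun [set: n.-tuple R] g ->
  (forall x, \sum_i (tnth x i) ^+ 2 = 1 -> `|g x| <= M) ->
  Q^T *m Q = 1%:M ->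
  (\int[P]_(w in D) g (col2tup (u w)) = \int[P]_(w in D) g (col2tup (Q *m u w)))%R.
Proof.
move=> mg gM QQ.
pose S := @unit_tuples R n; have mS : measurable S := @measurable_unit_tuples R n.
have mgS : measurable_fun [set: n.-tuple R] (g \_ S).
  by apply/(measurable_restrict _ mS measurableT); rewrite setTI; exact: measurable_funTS.
have gSM x : `|(g \_ S) x| <= `|M|.
  rewrite patchE; case: ifPn => [/set_mem /gM h|]; last by rewrite normr0.
  by rewrite (le_trans h)// ler_norm.
have SE w : S (col2tup (u w)) <-> D w.
  by rewrite /S /unit_tuples /D /= /unit_event/=; under eq_bigr do rewrite col2tupE.
have SQE w : S (col2tup (Q *m u w)) <-> D w.
  rewrite /S /unit_tuples /D /= /unit_event/=; under eq_bigr do rewrite col2tupE.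
  by rewrite sum_sqr_orthogonal.
rewrite Rintegral_mkcond [RHS]Rintegral_mkcond.
transitivity (\int[P]_w (g \_ S) (col2tup (u w)))%R.
  apply: eq_Rintegral => w _; rewrite !patchE.
  by rewrite (_ : (w \in D) = (col2tup (u w) \in S))//; apply/idP/idP; rewrite !inE => /SE.
transitivity (\int[P]_w (g \_ S) (col2tup (Q *m u w)))%R; last first.
  apply: eq_Rintegral => w _; rewrite !patchE.
  by rewrite (_ : (w \in D) = (col2tup (Q *m u w) \in S))//; apply/idP/idP; rewrite !inE => /SQE.
have PT : (P [set: T] < +oo)%E by rewrite probability_setT ltry.
apply: eq_law_Rintegral => //.
- exact: random_vector_mulmx.
- by move=> B mB; case: hu => _; apply.
- apply: (bounded_integrable (M := `|M|)) => // [|w _]; last exact: gSM.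
  exact: (measurableT_comp mgS mu).
- apply: (bounded_integrable (M := `|M|)) => // [|w _]; last exact: gSM.
  exact: (measurableT_comp mgS (random_vector_mulmx Q)).
Qed.

End spherical.

(** * Moment generating function of a Beta-distributed mass *)

(* With [c = 1 / (2 (n + 2))] and [p = m / n], [G = phi1 - (p + c s) phi0] satisfies
   [s G' <= G (s - n / 2 - p s - c s^2)]; the substitution [s = r^2] makes the
   integrating factor smooth at the origin whatever the parity of [n]. *)
Lemma kummer_subgaussian (R : realType) (n m : nat) (phi0 phi1 phi2 : R -> R) :
  (0 < n)%N ->
  (forall s : R, is_derive s 1 phi0 (phi1 s)) -> (forall s : R, is_derive s 1 phi1 (phi2 s)) ->
  (forall s, 0 <= phi0 s) -> phi0 0 = 1 ->
  (forall s, n%:R * phi1 s - m%:R * phi0 s = 2 * s * (phi1 s - phi2 s)) ->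
  forall s, 0 <= s ->
  phi0 s <= expR (m%:R / n%:R * s + s ^+ 2 / (4 * (n + 2)%:R)).
Proof.
move=> n0 d0 d1 phi_ge0 phi_init ode.
have nR : 0 < n%:R :> R by rewrite ltr0n.
pose p : R := m%:R / n%:R; pose c : R := (2 * (n%:R + 2))^-1.
have n2 : n%:R + 2 != 0 :> R by rewrite gt_eqF// addr_gt0.
pose G s := phi1 s - (p + c * s) * phi0 s.
pose G' s := phi2 s - (c * phi0 s + (p + c * s) * phi1 s).
have dG (s : R) : is_derive s 1 G (G' s).
  rewrite /G (_ : (fun s => _) = (fun s => phi1 s + -1 * ((p + c * s) * phi0 s))); last first.
    by apply/funext => y; rewrite mulN1r.
  apply: (is_derive_value (is_derive_pointwiseD (d1 s) (is_derive_pointwiseZ (-1)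
    (is_derive_pointwiseM (is_derive_pointwiseD (is_derive_cst p s 1)
       (is_derive_pointwiseZ c (is_derive_id s 1))) (d0 s))))).
  by rewrite /G' /=; ring.
have Gineq s : 0 <= s -> s * G' s <= G s * (s - n%:R / 2 - p * s - c * s ^+ 2).
  move=> s0; rewrite -subr_ge0.
  (* Once [phi2] is eliminated through the equation, [c (n / 2 + 1) = 1 / 4] is exactly the choice
     of [c] that turns the last factor into [(y - 1/2)^2] with [y = p + c s]. *)
  have -> : G s * (s - n%:R / 2 - p * s - c * s ^+ 2) - s * G' s =
      s * phi0 s * (4^-1 - (p + c * s) * (1 - (p + c * s))).
    have e : s * phi2 s = s * phi1 s - n%:R / 2 * phi1 s + n%:R / 2 * p * phi0 s.
      have -> : n%:R / 2 * p = m%:R / 2 :> R by rewrite /p; field; rewrite gt_eqF.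
      by have := ode s; lra.
    have e' : s * G' s = s * phi2 s - s * (c * phi0 s + (p + c * s) * phi1 s).
      by rewrite /G'; ring.
    have cE : 4^-1 = c * (n%:R / 2 + 1) :> R by rewrite /c; field.
    by rewrite e' e cE /G; ring.
  rewrite mulr_ge0 ?mulr_ge0//; move: (p + c * s) => y.
  by have : 0 <= (y - 2^-1) ^+ 2 by [exact: sqr_ge0]; nra.
(* [W] is [G] times the integrating factor [s^(n/2) exp (- (1 - p) s + c s^2 / 2)] at [s = r^2]. It
   vanishes at [r = 0] and does not increase afterwards, which gives the sign of [G]. *)
pose E r := - (1 - p) * r ^+ 2 + c / 2 * r ^+ 4.
pose W r := r ^+ n * (expR (E r) * G (r ^+ 2)).
pose E' r := - (1 - p) * (2 * r) + c / 2 * (4 * r ^+ 3).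
pose W' r := n%:R * r ^+ n.-1 * (expR (E r) * G (r ^+ 2)) +
  r ^+ n * (E' r * expR (E r) * G (r ^+ 2) + expR (E r) * (G' (r ^+ 2) * (2 * r))).
have dX k (r : R) : is_derive r 1 (fun r => r ^+ k) (k%:R * r ^+ k.-1).
  by apply: (is_derive_value (is_derive_pointwiseX k (is_derive_id r 1))); rewrite mulr1.
have dW (r : R) : is_derive r 1 W (W' r).
  apply: (is_derive_value (is_derive_pointwiseM (dX n r) (is_derive_pointwiseM
    (is_derive_comp_expR (is_derive_pointwiseD (is_derive_pointwiseZ (- (1 - p)) (dX 2%N r))
      (is_derive_pointwiseZ (c / 2) (dX 4%N r))))
    (@is_derive1_comp _ G (fun r => r ^+ 2) r _ _ (dG (r ^+ 2)) (dX 2%N r))))).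
  by rewrite /W' /E' /= expr1.
have W'_le0 r : 0 < r -> W' r <= 0.
  move=> r0; rewrite -(pmulr_rle0 _ r0).
  have -> : r * W' r = r ^+ n * expR (E r) *
      (n%:R * G (r ^+ 2) + r * E' r * G (r ^+ 2) + 2 * (r ^+ 2 * G' (r ^+ 2))).
    have e : r * r ^+ n.-1 = r ^+ n by rewrite -exprS prednK.
    by rewrite /W' mulrDr -!mulrA [r * (n%:R * _)]mulrCA [r * (r ^+ n.-1 * _)]mulrA e; ring.
  rewrite mulr_ge0_le0//; first by rewrite mulr_ge0 ?exprn_ge0 ?expR_ge0// ltW.
  have := Gineq (r ^+ 2) (sqr_ge0 r); rewrite /E'.
  move: (G (r ^+ 2)) (r ^+ 2 * G' _) => g h gh.
  have -> : n%:R * g + r * (- (1 - p) * (2 * r) + c / 2 * (4 * r ^+ 3)) * g + 2 * h =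
    2 * (h - g * (r ^+ 2 - n%:R / 2 - p * r ^+ 2 - c * (r ^+ 2) ^+ 2)) by field.
  by rewrite pmulr_rle0// subr_le0.
have G_le0 s : 0 <= s -> G s <= 0.
  (* At [s = 0] the factor [r^n] hides [G], and the equation itself yields [phi1 0 = p]. *)
  rewrite le_eqVlt => /predU1P[<-|s0].
    have := ode 0; rewrite /G phi_init mulr0 mul0r => /eqP; rewrite subr_eq0 => /eqP e.
    rewrite mulr0 addr0 !mulr1 /p subr_le0 ler_pdivlMr//; by rewrite mulrC e mulr1.
  have := le_start_of_derive_le0 dW W'_le0 (sqrtr_ge0 s).
  rewrite /W expr0n (gtn_eqF n0) mul0r sqr_sqrtr ?(ltW s0)//.
  by rewrite pmulr_rle0 ?exprn_gt0 ?sqrtr_gt0// pmulr_rle0 ?expR_gt0.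
(* [G <= 0] bounds the logarithmic derivative of [phi0] by [p + c s]; monotonicity of [H] is the
   integrated form. *)
pose H s := phi0 s * expR (- p * s + - (c / 2) * s ^+ 2).
have dH (s : R) : is_derive s 1 H (G s * expR (- p * s + - (c / 2) * s ^+ 2)).
  apply: (is_derive_value (is_derive_pointwiseM (d0 s) (is_derive_comp_expR
    (is_derive_pointwiseD (is_derive_pointwiseZ (- p) (is_derive_id s 1))
      (is_derive_pointwiseZ (- (c / 2)) (dX 2 s)))))).
  by rewrite /G expr1; field.
move=> s s0; have := le_start_of_derive_le0 dH _ s0.
rewrite {2}/H phi_init mul1r !mulr0 expr0n mulr0 addr0 expR0.
have H' x : 0 < x -> G x * expR (- p * x + - (c / 2) * x ^+ 2) <= 0.
  by move=> x0; rewrite mulr_le0_ge0 ?expR_ge0// G_le0// ltW.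
move=> /(_ H'); rewrite /H -ler_pdivlMr ?expR_gt0// div1r -expRN.
have -> // : - (- p * s + - (c / 2) * s ^+ 2) =
  m%:R / n%:R * s + s ^+ 2 / (4 * (n + 2)%:R).
by rewrite /p /c natrD; field; rewrite n2 gt_eqF.
Qed.

(** * A Stein identity on the sphere and the equation for the moment generating function *)

Section spherical_stein.
Variables (R : realType) (n : nat) (d : measure_display) (T : measurableType d).
Variables (P : probability T R) (u : T -> 'cV[R]_n).
Hypothesis mu : random_vector u.
Hypothesis hu : uniform_on_sphere P u.
Variable A : {set 'I_n}.

Let D := unit_event u.
Let mD : measurable D := measurable_unit_event mu.
Let PDoo : (P D < +oo)%E.
Proof. by rewrite (probability_unit_event hu) ltry. Qed.

Definition sqr_mass w : R := \sum_(l in A) (u w l 0) ^+ 2.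
Let X := sqr_mass.

Lemma measurable_sum_sqr_coord (B : pred 'I_n) :
  measurable_fun [set: T] (fun w => \sum_(l | B l) (u w l 0) ^+ 2).
Proof.
under eq_fun do rewrite big_mkcond; apply: measurable_sum => l.
by case: (B l) => //; apply: measurable_funX; exact: measurable_coord.
Qed.

Lemma measurable_sqr_mass : measurable_fun [set: T] sqr_mass.
Proof. exact: measurable_sum_sqr_coord. Qed.

Lemma sqr_massC w : D w -> \sum_(l | l \notin A) (u w l 0) ^+ 2 = 1 - X w.
Proof. by move=> Dw; rewrite -[X in _ = X - _]Dw [X in _ = X - _](bigID [in A])/= addrAC subrr add0r. Qed.

Lemma sqr_mass_itv w : D w -> 0 <= X w <= 1.
Proof.
move=> Dw; apply/andP; split; first by apply: sumr_ge0 => l _; exact: sqr_ge0.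
by rewrite -subr_ge0 -sqr_massC//; apply: sumr_ge0 => l _; exact: sqr_ge0.
Qed.

Lemma expR_itv_le (s y : R) : 0 <= y <= 1 -> expR (s * y) <= expR `|s|.
Proof.
move=> /andP[y0 y1]; rewrite ler_expR (le_trans (ler_norm _))// normrM.
by rewrite (ger0_norm y0) ler_piMr.
Qed.

(** By invariance, the mean of [x_i x_j e^(s X)] after rotating the coordinates [i] and [j] by an
    angle [t] does not depend on [t]; the identity is its derivative at [t = 0]. As [i] is in [A]
    and [j] is not, the rotation also moves [X], which produces the term in [s]; [C] is the part of
    [X] left fixed. *)
Let stein_pair i j s : i \in A -> j \notin A ->
  (\int[P]_(w in D) (((u w i 0) ^+ 2 - (u w j 0) ^+ 2
     - 2 * s * ((u w i 0) ^+ 2 * (u w j 0) ^+ 2)) * expR (s * X w)) = 0)%R.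
Proof.
move=> iA jA; have ij : i != j by apply: contraNneq jA => <-.
pose a t w := cos t * u w i 0 - sin t * u w j 0.
pose b t w := sin t * u w i 0 + cos t * u w j 0.
pose C w := \sum_(l in A | l != i) (u w l 0) ^+ 2.
pose g t w := a t w * b t w * expR (s * (C w + a t w ^+ 2)).
pose g' t w := (a t w ^+ 2 - b t w ^+ 2 - 2 * s * (a t w ^+ 2 * b t w ^+ 2))
  * expR (s * (C w + a t w ^+ 2)).
have XE w : X w = C w + u w i 0 ^+ 2 by rewrite /X /sqr_mass (bigD1 i)//= addrC.
have C0 w : 0 <= C w by apply: sumr_ge0 => l _; exact: sqr_ge0.
have CD w : D w -> C w + u w i 0 ^+ 2 + u w j 0 ^+ 2 <= 1.
  move=> Dw; rewrite -XE -lerBrDl -sqr_massC// (bigD1 j)//= lerDl.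
  by apply: sumr_ge0 => l _; exact: sqr_ge0.
have ab t w : a t w ^+ 2 + b t w ^+ 2 = u w i 0 ^+ 2 + u w j 0 ^+ 2.
  transitivity ((cos t ^+ 2 + sin t ^+ 2) * (u w i 0 ^+ 2 + u w j 0 ^+ 2)).
    by rewrite /a /b; ring.
  by rewrite cos2Dsin2 mul1r.
have da w (t : R) : is_derive t 1 (a ^~ w) (- b t w).
  rewrite /a (_ : (fun _ => _) = (fun t => u w i 0 * cos t + - u w j 0 * sin t)).
    apply: (is_derive_value (is_derive_pointwiseD
      (is_derive_pointwiseZ _ (is_derive_cos t)) (is_derive_pointwiseZ _ (is_derive_sin t)))).
    by rewrite /b; ring.
  by apply/funext => y; ring.
have db w (t : R) : is_derive t 1 (b ^~ w) (a t w).
  rewrite /b (_ : (fun _ => _) = (fun t => u w i 0 * sin t + u w j 0 * cos t)).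
    apply: (is_derive_value (is_derive_pointwiseD
      (is_derive_pointwiseZ _ (is_derive_sin t)) (is_derive_pointwiseZ _ (is_derive_cos t)))).
    by rewrite /a; ring.
  by apply/funext => y; ring.
have dg (t : R) w : is_derive t 1 (g ^~ w) (g' t w).
  apply: (is_derive_value (is_derive_pointwiseM (is_derive_pointwiseM (da w t) (db w t))
    (is_derive_comp_expR (is_derive_pointwiseZ s
      (is_derive_pointwiseD (is_derive_cst (C w) t 1) (is_derive_pointwiseX 2 (da w t))))))).
  by rewrite /g' expr1; ring.
have ma t : measurable_fun [set: T] (a t).
  by apply: measurable_funB; apply: measurable_funM => //; exact: measurable_coord.
have mb t : measurable_fun [set: T] (b t).
  by apply: measurable_funD; apply: measurable_funM => //; exact: measurable_coord.
have mg t : measurable_fun D (g t).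
  apply: measurable_funTS; apply: measurable_funM; first exact: measurable_funM.
  apply: measurableT_comp => //; apply: measurable_funM => //.
  apply: measurable_funD; last exact: measurable_funX.
  exact: measurable_sum_sqr_coord.
pose M := (1 + 2 * `|s|) * expR `|s|.
have bM t w : D w -> `|g t w| <= M /\ `|g' t w| <= M.
  move=> Dw; have := ab t w; have := CD w Dw; have := C0 w.
  have := sqr_ge0 (a t w); have := sqr_ge0 (b t w).
  rewrite /g /g' !normrM [`|expR _|]ger0_norm ?expR_ge0// => b2 a2 C2 CD2 abE.
  have yI : 0 <= C w + a t w ^+ 2 <= 1 by apply/andP; split; lra.
  have s0 : 0 <= `|s| by exact: normr_ge0.
  have a1 : `|a t w| <= 1 by rewrite -(@expr_le1 _ 2)// real_normK ?num_real//; lra.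
  have b1 : `|b t w| <= 1 by rewrite -(@expr_le1 _ 2)// real_normK ?num_real//; lra.
  split; rewrite /M; apply: ler_pM; rewrite ?mulr_ge0 ?expR_ge0 ?expR_itv_le//.
    apply: (@le_trans _ _ 1); last by lra.
    by rewrite -[X in _ <= X]mulr1 ler_pM.
  rewrite (le_trans (ler_normB _ _))// lerD//.
    by rewrite ler_norml; apply/andP; split; lra.
  rewrite normrM [`|2 * s|]normrM normr_nat ler_piMr ?mulr_ge0//.
  by rewrite (ger0_norm (mulr_ge0 a2 b2)) -[X in _ <= X]mulr1 ler_pM//; lra.
have := is_derive_Rintegral (a := 0) (M := M) mD PDoo mg (fun t w _ => dg t w)
  (fun t w _ Dw => bM t w Dw).
have -> : (fun t => \int[P]_(w in D) g t w)%R = cst (\int[P]_(w in D) g 0 w)%R.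
  apply/funext => t /=.
  pose G (x : n.-tuple R) := tnth x i * tnth x j * expR (s * \sum_(l in A) tnth x l ^+ 2).
  have mG : measurable_fun [set: n.-tuple R] G.
    apply: measurable_funM.
      by apply: measurable_funM; exact: measurable_tnth.
    apply: measurableT_comp => //; apply: measurable_funM => //.
    under eq_fun do rewrite big_mkcond; apply: measurable_sum => l.
    by case: (l \in A) => //; apply: measurable_funX; exact: measurable_tnth.
  have GM x : \sum_l tnth x l ^+ 2 = 1 -> `|G x| <= expR `|s|.
    move=> x1; have le1 (B : pred 'I_n) : \sum_(l | B l) tnth x l ^+ 2 <= 1.
      rewrite -x1 [X in _ <= X](bigID B)/= lerDl.
      by apply: sumr_ge0 => l _; exact: sqr_ge0.
    have t1 l : `|tnth x l| <= 1.
      by rewrite -(@expr_le1 _ 2)// real_normK ?num_real//; have := le1 (pred1 l); rewrite big_pred1_eq.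
    rewrite /G !normrM [`|expR _|]ger0_norm ?expR_ge0// -[X in _ <= X]mul1r.
    rewrite ler_pM ?mulr_ge0 ?expR_ge0//; first by rewrite -[X in _ <= X]mulr1 ler_pM.
    rewrite expR_itv_le// le1 andbT; apply: sumr_ge0 => l _; exact: sqr_ge0.
  have inv := rotation_invariance mu hu mG GM (plane_rotation_orthogonal ij t).
  transitivity (\int[P]_(w in D) G (col2tup (u w)))%R; last first.
    apply: eq_Rintegral => w _; rewrite /G /g /a /b !col2tupE cos0 sin0.
    rewrite !mul1r !mul0r subr0 add0r; congr (_ * expR (s * _)).
    by rewrite -XE; apply: eq_bigr => l _; rewrite col2tupE.
  rewrite inv; apply: eq_Rintegral => w _; rewrite /G /g !col2tupE !plane_rotationE eqxx.
  rewrite eq_sym (negbTE ij) eqxx; congr (_ * expR (s * _)).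
  rewrite (bigD1 i)//= col2tupE plane_rotationE eqxx addrC; congr (_ + _).
  apply: eq_bigr => l /andP[lA li]; rewrite col2tupE plane_rotationE (negbTE li).
  by case: eqP => // lj; rewrite -lj lA in jA.
move=> [_]; rewrite derive_cst => /esym; congr (_ = _); apply: eq_Rintegral => w _.
rewrite /g' /a /b cos0 sin0 !mul1r !mul0r subr0 add0r; congr (_ * expR (s * _)).
by rewrite XE.
Qed.

(** The derivative of order [k] of the moment generating function of [X]; the orders [0], [1], [2]
    are the three functions of [kummer_subgaussian]. *)
Definition mgf_moment k s := (\int[P]_(w in D) (X w ^+ k * expR (s * X w)))%R.

Let measurable_moment k s : measurable_fun D (fun w => X w ^+ k * expR (s * X w)).
Proof.
apply: measurable_funTS; apply: measurable_funM.
  by apply: measurable_funX; exact: measurable_sqr_mass.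
apply: measurableT_comp => //; apply: measurable_funM => //; exact: measurable_sqr_mass.
Qed.

Let moment_bound k s w : D w -> `|X w ^+ k * expR (s * X w)| <= expR `|s|.
Proof.
move=> /sqr_mass_itv XI; case/andP: (XI) => X0 X1.
rewrite ger0_norm ?mulr_ge0 ?exprn_ge0 ?expR_ge0// -[X in _ <= X]mul1r.
by rewrite ler_pM ?exprn_ge0 ?expR_ge0 ?exprn_ile1 ?expR_itv_le.
Qed.

Let integrable_moment k s : P.-integrable D (EFin \o (fun w => X w ^+ k * expR (s * X w))).
Proof. exact: (bounded_integrable mD PDoo (measurable_moment k s) (@moment_bound k s)). Qed.

Lemma is_derive_mgf_moment k (s : R) : is_derive s 1 (mgf_moment k) (mgf_moment k.+1 s).
Proof.
apply: (@is_derive_Rintegral _ _ _ P D (fun s w => X w ^+ k * expR (s * X w))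
  (fun s w => X w ^+ k.+1 * expR (s * X w)) s (expR (`|s| + 1)) mD PDoo (measurable_moment k)).
  move=> x w _.
  rewrite (_ : (fun _ => _) = (fun y => X w ^+ k * expR (X w * y))); last first.
    by apply/funext => y; rewrite [y * _]mulrC.
  apply: (is_derive_value (is_derive_pointwiseZ (X w ^+ k)
    (is_derive_comp_expR (is_derive_pointwiseZ (X w) (is_derive_id x 1))))).
  by rewrite mulr1 mulrA -exprSr [x * _]mulrC.
move=> x w /andP[sx xs] Dw; have xs1 : `|x| <= `|s| + 1.
  rewrite -lerBlDl (le_trans (lerB_dist _ _))// ler_norml; apply/andP; split; lra.
by split; rewrite (le_trans (moment_bound _ _ Dw))// ler_expR.
Qed.

(** Sum [stein_pair] over all [i] in [A] and [j] outside. On the sphere the squares add up to [X]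
    and [1 - X], so with [m = #|A|] the polynomial factor becomes
    [(n - m) X - m (1 - X) - 2 s X (1 - X)]. *)
Lemma mgf_moment_stein s :
  n%:R * mgf_moment 1 s - #|A|%:R * mgf_moment 0 s =
  2 * s * (mgf_moment 1 s - mgf_moment 2 s).
Proof.
apply/eqP; rewrite -subr_eq0; apply/eqP.
pose h i j w := ((u w i 0) ^+ 2 - (u w j 0) ^+ 2
     - 2 * s * ((u w i 0) ^+ 2 * (u w j 0) ^+ 2)) * expR (s * X w).
have ih i j : P.-integrable D (EFin \o h i j).
  apply: (bounded_integrable (M := (2 + `|2 * s|) * expR `|s|) mD PDoo).
    apply: measurable_funTS; apply: measurable_funM.
      apply: measurable_funB.
        by apply: measurable_funB; apply: measurable_funX; exact: measurable_coord.
      by apply: measurable_funM => //; apply: measurable_funM; apply: measurable_funX;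
        exact: measurable_coord.
    apply: measurableT_comp => //; apply: measurable_funM => //; exact: measurable_sqr_mass.
  move=> w Dw; have x1 l : 0 <= (u w l 0) ^+ 2 <= 1.
    rewrite sqr_ge0/= -[X in _ <= X]Dw [X in _ <= X](bigD1 l)//= lerDl.
    by apply: sumr_ge0 => q _; exact: sqr_ge0.
  rewrite /h normrM [`|expR _|]ger0_norm ?expR_ge0// ler_pM ?expR_ge0 ?expR_itv_le ?sqr_mass_itv//.
  case/andP: (x1 i) => i0 i1; case/andP: (x1 j) => j0 j1.
  rewrite (le_trans (ler_normB _ _))// lerD//.
    by rewrite ler_norml; apply/andP; split; lra.
  rewrite normrM ler_piMr// (ger0_norm (mulr_ge0 i0 j0)) -[X in _ <= X]mulr1 ler_pM//.
transitivity (\int[P]_(w in D) \sum_(i in A) \sum_(j | j \notin A) h i j w)%R; last first.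
  rewrite Rintegral_sum//.
    rewrite big1// => i iA; rewrite Rintegral_sum// big1// => j jA.
    exact: stein_pair.
  move=> i; rewrite (_ : EFin \o _ = fun w => (\sum_(j | j \notin A) (h i j w)%:E)%E).
    by apply: integrable_sum => // j _; exact: ih.
  by apply/funext => w; rewrite /= sumEFin.
have zi c k : P.-integrable D (EFin \o (fun w => c * (X w ^+ k * expR (s * X w)))).
  exact: (integrableZl mD c (integrable_moment k s)).
pose f k w := X w ^+ k * expR (s * X w).
have i10 : P.-integrable D (EFin \o (fun w => n%:R * f 1 w - #|A|%:R * f 0 w)).
  exact: (integrableB mD (zi n%:R 1) (zi #|A|%:R 0)).
have i12 : P.-integrable D (EFin \o (fun w => f 1 w - f 2 w)).
  exact: (integrableB mD (integrable_moment 1 s) (integrable_moment 2 s)).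
have i12' : P.-integrable D (EFin \o (fun w => 2 * s * (f 1 w - f 2 w))).
  exact: (integrableZl mD (2 * s) i12).
transitivity (\int[P]_(w in D)
    (n%:R * f 1 w - #|A|%:R * f 0 w - 2 * s * (f 1 w - f 2 w)))%R.
  rewrite (RintegralB mD i10 i12') (RintegralB mD (zi n%:R 1) (zi #|A|%:R 0)).
  rewrite (RintegralZl (2 * s) mD i12).
  rewrite (RintegralB mD (integrable_moment 1 s) (integrable_moment 2 s)).
  by rewrite (RintegralZl _ mD (integrable_moment 1 s)) (RintegralZl _ mD (integrable_moment 0 s)).
rewrite /f.
apply: eq_Rintegral => w /set_mem Dw.
rewrite /h; under [RHS]eq_bigr do rewrite -mulr_suml.
rewrite -mulr_suml.
have -> : \sum_(i in A) \sum_(j | j \notin A) ((u w i 0) ^+ 2 - (u w j 0) ^+ 2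
     - 2 * s * ((u w i 0) ^+ 2 * (u w j 0) ^+ 2)) =
   (n%:R - #|A|%:R) * X w - #|A|%:R * (1 - X w) - 2 * s * (X w * (1 - X w)).
  have cardC : \sum_(j | j \notin A) (1 : R) = n%:R - #|A|%:R.
    apply/eqP; rewrite eq_sym subr_eq sumr_const -natrD eqr_nat addnC.
    by rewrite -[X in X == _](card_ord n) -(cardC A).
  have cstE (a : R) : \sum_(j | j \notin A) a = a * (n%:R - #|A|%:R).
    by rewrite -cardC mulr_sumr mulr1.
  rewrite (eq_bigr (fun i => (u w i 0) ^+ 2 * (n%:R - #|A|%:R) - (1 - X w)
      - 2 * s * ((u w i 0) ^+ 2 * (1 - X w)))); last first.
    move=> i _; rewrite sumrB sumrB cstE sqr_massC//; congr (_ - _).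
    by rewrite -(sqr_massC Dw) !mulr_sumr.
  have e1 : \sum_(i in A) (u w i 0) ^+ 2 * (n%:R - #|A|%:R) = X w * (n%:R - #|A|%:R).
    by rewrite -mulr_suml.
  have e2 : \sum_(i in A) (1 - X w) = #|A|%:R * (1 - X w).
    by rewrite sumr_const mulr_natl.
  have e3 : \sum_(i in A) 2 * s * ((u w i 0) ^+ 2 * (1 - X w)) =
      2 * s * (X w * (1 - X w)).
    by rewrite -mulr_sumr -mulr_suml.
  by rewrite sumrB sumrB e1 e2 e3; ring.
by rewrite expr0 expr1; ring.
Qed.

End spherical_stein.

(** * Independence and concentration *)

Lemma Rintegral_indic (d : measure_display) (T : measurableType d) (R : realType)
    (mu : {measure set T -> \bar R}) (E : set T) : measurable E ->
  (\int[mu]_w \1_E w = fine (mu E))%R.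
Proof. by move=> mE; rewrite /Rintegral integral_indic// setIT. Qed.

Lemma prod_indic (R : realType) (N : nat) (T : Type) (E : 'I_N -> set T) (w : T) :
  \prod_i \1_(E i) w = \1_(\bigcap_(i in [set: 'I_N]) E i) w :> R.
Proof.
rewrite indicE; case: (boolP (w \in _)) => [/set_mem h|/negP h].
  by rewrite big1// => i _; rewrite indicE mem_set//; apply: h.
have [j] : exists j, ~ E j w.
  by apply/not_existsP => h'; apply: h; apply/mem_set => i _; apply: contrapT; exact: h'.
by move=> Ej; rewrite (bigD1 j)//= indicE memNset// mul0r.
Qed.

Section independent_product.
Variables (R : realType) (d d' : measure_display) (T : measurableType d).
Variables (Y : measurableType d') (P : probability T R) (N : nat).
Variables (Z : 'I_N -> T -> Y) (f : Y -> R) (M b : R).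
Hypothesis mZ : forall i, measurable_fun [set: T] (Z i).
Hypothesis indep : forall B : 'I_N -> set Y, (forall i, measurable (B i)) ->
  P (\bigcap_(i in [set: 'I_N]) [set w | B i (Z i w)]) =
  (\prod_(i < N) P [set w | B i (Z i w)])%E.
Hypothesis mf : measurable_fun [set: Y] f.
Hypothesis f_itv : forall y, 0 <= f y <= M.
Hypothesis f_mean : forall i, (\int[P]_w f (Z i w))%R <= b.

Let PT : (P [set: T] < +oo)%E.
Proof. by rewrite probability_setT ltry. Qed.

Let mpre i (B : set Y) : measurable B -> measurable [set w | B (Z i w)].
Proof. by move=> mB; rewrite -[X in measurable X]setTI; exact: mZ. Qed.

Section discretization.
Variable e : R.
Hypothesis e0 : 0 < e.

(** Independence is stated for events only, so [f] is replaced by a step function. The [L] levels of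
    height [e] cover [[0, M]], and each takes its upper end as value: [S] dominates [f] and exceeds
    it by at most [e]. *)
Let L := (Num.truncn (M / e)).+1.
Let B (l : 'I_L) : set Y := f @^-1` `[l%:R * e, l.+1%:R * e[%classic.
Let F (l : 'I_L) : R := l.+1%:R * e.
Let S y := \sum_l F l * \1_(B l) y.

Let mB l : measurable (B l).
Proof. by rewrite /B -[X in measurable X]setTI; exact: mf. Qed.

Let S_itv y : f y <= S y <= f y + e.
Proof.
case/andP: (f_itv y) => f0 fM.
have fe0 : 0 <= f y / e by rewrite divr_ge0// ltW.
have cL : (Num.truncn (f y / e) < L)%N.
  by rewrite ltnS le_truncn// ler_pM2r ?invr_gt0.
have Bc : B (Ordinal cL) y.
  rewrite /B/= in_itv/= -ler_pdivlMr// -ltr_pdivrMr//.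
  by have := truncn_itv fe0.
have -> : S y = F (Ordinal cL).
  rewrite /S (bigD1 (Ordinal cL))//= indicE mem_set// mulr1 big1 ?addr0//.
  move=> l lc; rewrite indicE memNset ?mulr0// /B/= in_itv/= -ler_pdivlMr// -ltr_pdivrMr//.
  by move=> h; move/negP: lc; apply; apply/eqP/val_inj => /=; apply/esym/truncn_def.
move: Bc; rewrite /B/= in_itv/= /F/= => /andP[lo hi].
by rewrite (ltW hi)/= -natr1 mulrDl mul1r lerD2r.
Qed.

Let mS : measurable_fun [set: Y] S.
Proof. by apply: measurable_sum => l; apply: measurable_funM. Qed.

Let integrable_indicZ (c : R) (E : set T) : measurable E ->
  P.-integrable [set: T] (EFin \o (fun w => c * \1_E w)).
Proof.
move=> mE; apply: (bounded_integrable (M := `|c|)) => //.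
  by apply: measurable_funM => //; exact: measurable_indic.
move=> w _; rewrite normrM ler_piMr// ger0_norm// indicE; by case: (_ \in _).
Qed.

Let mean_S i : \sum_l F l * fine (P [set w | B l (Z i w)]) <= b + e.
Proof.
have -> : \sum_l F l * fine (P [set w | B l (Z i w)]) = (\int[P]_w S (Z i w))%R.
  rewrite /S (Rintegral_sum _ _ (f := fun l w => F l * \1_(B l) (Z i w)))//; last first.
    by move=> l; exact: (integrable_indicZ (F l) (mpre i (mB l))).
  apply: eq_bigr => l _; rewrite -(Rintegral_indic P (mpre i (mB l))) -RintegralZl//.
  by have := integrable_indicZ 1 (mpre i (mB l)); apply: eq_integrable => // w _ /=; rewrite mul1r.
have fi : P.-integrable [set: T] (EFin \o (fun w => f (Z i w))).
  apply: (bounded_integrable (M := M)) => //; first exact: (measurableT_comp mf (mZ i)).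
  by move=> w _; case/andP: (f_itv (Z i w)) => h1 h2; rewrite ger0_norm.
have ei : P.-integrable [set: T] (EFin \o cst e).
  by apply: (bounded_integrable (M := `|e|)).
have Si : P.-integrable [set: T] (EFin \o (fun w => S (Z i w))).
  apply: (bounded_integrable (M := M + e)) => //; first exact: (measurableT_comp mS (mZ i)).
  move=> w _; case/andP: (f_itv (Z i w)) => h1 h2; case/andP: (S_itv (Z i w)) => h3 h4.
  by rewrite ger0_norm; lra.
apply: (@le_trans _ _ (\int[P]_w (f (Z i w) + e))%R).
  apply: le_Rintegral => //; last by move=> w _; case/andP: (S_itv (Z i w)).
  exact: (integrableD measurableT fi ei).
rewrite (RintegralD measurableT fi ei) Rintegral_cst//.
have -> : fine (P [set: T]) = 1 by rewrite probability_setT.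
by rewrite mulr1 lerD2r f_mean.
Qed.

Let S_ge0 y : 0 <= S y.
Proof. by case/andP: (f_itv y) => f0 _; case/andP: (S_itv y) => /(le_trans f0). Qed.

(** Expanding the product of sums gives one term per choice of levels; each is a multiple of the
    indicator of an intersection, to which independence applies. *)
Let mean_prod_S : (\int[P]_w \prod_i S (Z i w) =
  \prod_(i < N) \sum_l F l * fine (P [set w | B l (Z i w)]))%R.
Proof.
pose E (k : {ffun 'I_N -> 'I_L}) : set T :=
  \bigcap_(i in [set: 'I_N]) [set w | B (k i) (Z i w)].
have mE k : measurable (E k).
  by apply: fin_bigcap_measurable => // i _; exact: mpre.
rewrite bigA_distr_bigA/=.
transitivity (\int[P]_w \sum_(k : {ffun 'I_N -> 'I_L}) (\prod_i F (k i)) * \1_(E k) w)%R.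
  apply: eq_Rintegral => w _; rewrite /S bigA_distr_bigA/=; apply: eq_bigr => k _.
  by rewrite big_split/=; congr (_ * _); rewrite -prod_indic.
rewrite Rintegral_sum//; last by move=> k; exact: integrable_indicZ.
apply: eq_bigr => k _; rewrite RintegralZl//; last first.
  by have := integrable_indicZ 1 (mE k); apply: eq_integrable => // w _ /=; rewrite mul1r.
rewrite Rintegral_indic// [RHS]big_split/=; congr (_ * _).
rewrite /E (indep (B := fun i => B (k i)))//.
apply: (@EFin_inj R); rewrite fineK; last first.
  by apply: prode_fin_num => i _; rewrite fin_num_measure//; exact: mpre.
elim/big_rec2 : _ => // i x y _ ->.
by rewrite EFinM fineK// fin_num_measure//; exact: mpre.
Qed.

Lemma independent_markov_discretized (E : set T) (K : R) : measurable E -> 0 <= K ->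
  (forall w, E w -> 1 <= K * \prod_i f (Z i w)) -> fine (P E) <= K * (b + e) ^+ N.
Proof.
move=> mE K0 EK.
have Si : P.-integrable [set: T] (EFin \o (fun w => \prod_i S (Z i w))).
  apply: (bounded_integrable (M := (M + e) ^+ N)) => //.
    by apply: measurable_prod => i _; exact: (measurableT_comp mS (mZ i)).
  move=> w _; rewrite ger0_norm ?prodr_ge0// -[X in _ ^+ X](card_ord N) -prodr_const.
  apply: ler_prod => i _; rewrite S_ge0/=.
  by case/andP: (f_itv (Z i w)) => h1 h2; case/andP: (S_itv (Z i w)) => h3 h4; lra.
rewrite -Rintegral_indic//; apply: (@le_trans _ _ (\int[P]_w (K * \prod_i S (Z i w)))%R).
  apply: le_Rintegral => //.
  - by have := integrable_indicZ 1 mE; apply: eq_integrable => // w _ /=; rewrite mul1r.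
  - exact: (integrableZl measurableT K Si).
  move=> w _; rewrite indicE; case: (boolP (w \in E)) => [/set_mem/EK h|_]; last first.
    by rewrite mulr_ge0// prodr_ge0.
  rewrite (le_trans h)// ler_wpM2l// ler_prod// => i _.
  by case/andP: (f_itv (Z i w)) => -> _; case/andP: (S_itv (Z i w)).
rewrite (RintegralZl _ _ Si)// mean_prod_S ler_wpM2l//.
rewrite -[X in _ ^+ X](card_ord N) -prodr_const; apply: ler_prod => i _.
rewrite mean_S andbT; apply: sumr_ge0 => l _.
by rewrite mulr_ge0 ?fine_ge0// /F mulr_ge0// ltW.
Qed.

End discretization.

(** The mesh [e] tends to [0]: if the bound failed, continuity of [K x^N] at [b] would leave room
    for a positive [e] that contradicts the discretized bound. *)
Lemma independent_markov (E : set T) (K : R) : measurable E -> 0 <= K ->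
  (forall w, E w -> 1 <= K * \prod_i f (Z i w)) -> fine (P E) <= K * b ^+ N.
Proof.
move=> mE K0 EK; rewrite leNgt; apply/negP => lt.
have : (fun x : R => K * x ^+ N) x @[x --> b] --> K * b ^+ N.
  by apply: cvgM; [exact: cvg_cst|exact: exprn_continuous].
move=> /cvgr_lt/(_ _ lt) [e /= e0 be].
have e20 : 0 < e / 2 by rewrite divr_gt0.
have := be (b + e / 2); rewrite /ball_/= opprD addrA subrr sub0r normrN gtr0_norm//.
rewrite ltr_pdivrMr// ltr_pMr// ltr1n => /(_ isT).
by rewrite ltNge independent_markov_discretized.
Qed.

End independent_product.

Lemma spherical_mgf_le (R : realType) (n : nat) (d : measure_display)
    (T : measurableType d) (P : probability T R) (u : T -> 'cV[R]_n) (A : {set 'I_n}) (s : R) :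
  (0 < n)%N -> random_vector u -> uniform_on_sphere P u -> 0 <= s ->
  mgf_moment P u A 0 s <= expR (#|A|%:R / n%:R * s + s ^+ 2 / (4 * (n + 2)%:R)).
Proof.
move=> n0 mu hu; apply: (kummer_subgaussian (phi1 := mgf_moment P u A 1)
    (phi2 := mgf_moment P u A 2) n0).
- exact: is_derive_mgf_moment.
- exact: is_derive_mgf_moment.
- by move=> y; apply: Rintegral_ge0 => w _; rewrite mul1r expR_ge0.
- rewrite /mgf_moment; under eq_Rintegral do rewrite expr0 mul0r expR0 mulr1.
  rewrite Rintegral_cst; last exact: measurable_unit_event.
  by rewrite mul1r -[RHS]/(fine 1%E) -(probability_unit_event hu).
- exact: mgf_moment_stein.
Qed.

(** * Upper tails of the averaged mass on a set of coordinates *)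

Section spherical_tail.
Variables (R : realType) (n N : nat) (d : measure_display) (T : measurableType d).
Variables (P : probability T R) (u : 'I_N -> T -> 'cV[R]_n).
Hypothesis n_gt0 : (0 < n)%N.
Hypothesis mu : forall i, random_vector (u i).
Hypothesis hu : forall i, uniform_on_sphere P (u i).
Hypothesis indep : mutually_independent P u.

Definition tail_event (A : {set 'I_n}) (tau : R) : set T :=
  \bigcap_(i in [set: 'I_N]) unit_event (u i) `&`
  [set w | N%:R * (#|A|%:R / n%:R + tau) <= \sum_i sqr_mass (u i) A w].

Lemma measurable_tail_event A tau : measurable (tail_event A tau).
Proof.
apply: measurableI.
  by apply: fin_bigcap_measurable => // i _; exact: measurable_unit_event.
rewrite -[X in measurable X]setTI.
have mS : measurable_fun [set: T] (fun w => \sum_i sqr_mass (u i) A w).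
  by apply: measurable_sum => i; exact: measurable_sqr_mass.
have := measurable_fun_ler (measurable_cst (N%:R * (#|A|%:R / n%:R + tau))) mS.
by move=> /(_ measurableT [set true] I).
Qed.

(* Chernoff's bound with the optimal parameter [2 (n + 2) tau]. *)
Lemma tail_event_le A tau : 0 <= tau ->
  fine (P (tail_event A tau)) <= expR (- (N%:R * (n + 2)%:R * tau ^+ 2)).
Proof.
move=> tau0; pose s : R := 2 * (n + 2)%:R * tau; pose p : R := #|A|%:R / n%:R.
have s0 : 0 <= s by rewrite !mulr_ge0.
pose S := @unit_tuples R n; have mS : measurable S := @measurable_unit_tuples R n.
pose g (x : n.-tuple R) := expR (s * \sum_(l in A) tnth x l ^+ 2).
have mg : measurable_fun [set: n.-tuple R] g.
  apply: measurableT_comp => //; apply: measurable_funM => //.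
  under eq_fun do rewrite big_mkcond; apply: measurable_sum => l.
  by case: (l \in A) => //; apply: measurable_funX; exact: measurable_tnth.
have SE i w : S (col2tup (u i w)) <-> unit_event (u i) w.
  by rewrite /S /unit_tuples /unit_event/=; under eq_bigr do rewrite col2tupE.
have gE i w : g (col2tup (u i w)) = expR (s * sqr_mass (u i) A w).
  by rewrite /g /sqr_mass; under eq_bigr do rewrite col2tupE.
(* The product bound needs a function bounded everywhere; the cut-off changes nothing on
   [tail_event], which includes the unit norms. *)
pose f := g \_ S.
have mf : measurable_fun [set: n.-tuple R] f.
  by apply/(measurable_restrict _ mS measurableT); rewrite setTI; exact: measurable_funTS.
have f_itv x : 0 <= f x <= expR s.
  rewrite /f patchE; case: ifPn => [/set_mem Sx|_]; last by rewrite lexx expR_ge0.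
  rewrite expR_ge0/= ler_expR -[X in _ <= X]mulr1 ler_wpM2l// -[X in _ <= X]Sx.
  rewrite [X in _ <= X](bigID [in A])/= lerDl.
  by apply: sumr_ge0 => l _; exact: sqr_ge0.
pose b := expR (p * s + s ^+ 2 / (4 * (n + 2)%:R)).
have f_mean i : (\int[P]_w f (col2tup (u i w)))%R <= b.
  apply: le_trans (spherical_mgf_le A n_gt0 (mu i) (hu i) s0).
  rewrite /mgf_moment [X in _ <= X]Rintegral_mkcond le_eqVlt; apply/orP; left; apply/eqP.
  apply: eq_Rintegral => w _; rewrite /f !patchE.
  rewrite (_ : (w \in _) = (col2tup (u i w) \in S)); last first.
    by apply/idP/idP; rewrite !inE => /SE.
  by case: ifP => // _; rewrite mul1r gE.
have := independent_markov (K := expR (- (s * (N%:R * (p + tau))))) mu indep mf f_itv f_mean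
  (measurable_tail_event A tau) (expR_ge0 _).
rewrite -/p => H; apply: le_trans (H _) _.
  move=> w [uw tw]; rewrite (eq_bigr (fun i => expR (s * sqr_mass (u i) A w))); last first.
    by move=> i _; rewrite /f patchE mem_set ?gE//; apply/SE/uw.
  rewrite -expR_sum -mulr_sumr -expRD -[X in X <= _]expR0 ler_expR addrC subr_ge0.
  exact: ler_wpM2l.
rewrite -expRM_natl -expRD ler_expR le_eqVlt; apply/orP; left; apply/eqP.
have n2 : (n + 2)%:R != 0 :> R by rewrite pnatr_eq0; lia.
by rewrite /s -mulr_natl; field.
Qed.

End spherical_tail.

(** * Triangle inequality, convexity and a sup-norm bound for the Wasserstein distance *)

Section dW_lemmas.
Variable R : realType.
Implicit Types F G H : R -> R.

Let mabsB F G : measurable_fun [set: R] F -> measurable_fun [set: R] G ->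
  measurable_fun [set: R] (fun x => (`|F x - G x|)%:E).
Proof.
by move=> mF mG; apply/measurable_EFinP; apply: measurableT_comp => //; exact: measurable_funB.
Qed.

Lemma dW_triangle F G H : measurable_fun [set: R] F -> measurable_fun [set: R] G ->
  measurable_fun [set: R] H -> (dW F H <= dW F G + dW G H)%E.
Proof.
move=> mF mG mH; rewrite /dW -ge0_integralD//; last 2 first.
- exact: mabsB.
- exact: mabsB.
apply: ge0_le_integral => //.
- exact: mabsB.
- by apply: emeasurable_funD; exact: mabsB.
by move=> x _; rewrite -EFinD lee_fin; exact: ler_distD.
Qed.

Lemma dW_mean (N : nat) (F G : 'I_N -> R -> R) (C : R) : (0 < N)%N ->
  (forall i, measurable_fun [set: R] (F i)) -> (forall i, measurable_fun [set: R] (G i)) ->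
  (forall i, (dW (F i) (G i) <= C%:E)%E) ->
  (dW (fun x => N%:R^-1 * \sum_i F i x)%R (fun x => N%:R^-1 * \sum_i G i x)%R <= C%:E)%E.
Proof.
move=> N0 mF mG FG; have NR : 0 < N%:R :> R by rewrite ltr0n.
have mean_measurable (K : 'I_N -> R -> R) : (forall i, measurable_fun [set: R] (K i)) ->
    measurable_fun [set: R] (fun x => N%:R^-1 * \sum_i K i x).
  by move=> mK; apply: measurable_funM => //; exact: measurable_sum.
apply: (@le_trans _ _ (\int[@lebesgue_measure R]_x
    ((N%:R^-1)%:E * \sum_i (`|F i x - G i x|)%:E))%E).
  apply: ge0_le_integral => //.
  - by apply: mabsB; exact: mean_measurable.
  - apply: emeasurable_funM => //; apply: emeasurable_sum => i; exact: mabsB.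
  move=> x _; rewrite sumEFin -EFinM lee_fin -mulrBr normrM gtr0_norm ?invr_gt0//.
  by rewrite ler_wpM2l ?invr_ge0// -sumrB ler_norm_sum.
rewrite ge0_integralZl//; last 2 first.
- by apply: emeasurable_sum => i; exact: mabsB.
- by move=> x _; rewrite sume_ge0.
rewrite ge0_integral_sum//; last by move=> i; exact: mabsB.
apply: (@le_trans _ _ ((N%:R^-1)%:E * \sum_(i < N) C%:E)%E).
  by rewrite lee_pmul2l ?lte_fin ?invr_gt0//; apply: lee_sum => i _; exact: FG.
by rewrite sumEFin sumr_const card_ord -EFinM -[C *+ N]mulr_natl mulKf ?gt_eqF.
Qed.

Lemma dW_le_itv F G (a b tau : R) : a <= b -> 0 <= tau ->
  measurable_fun [set: R] F -> measurable_fun [set: R] G ->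
  (forall x, ~ (a <= x < b) -> F x = G x) ->
  (forall x, a <= x < b -> `|F x - G x| <= tau) ->
  (dW F G <= (tau * (b - a))%:E)%E.
Proof.
move=> ab tau0 mF mG out inn.
apply: (@le_trans _ _ (\int[@lebesgue_measure R]_x (tau%:E * (\1_`[a, b[ x)%:E))%E).
  apply: ge0_le_integral => //.
  - exact: mabsB.
  - by apply: emeasurable_funM => //; exact/measurable_EFinP.
  move=> x _; rewrite -EFinM lee_fin indicE mem_setE in_itv/=.
  case: (boolP (a <= x < b)) => [/inn|/negP/out ->]; first by rewrite mulr1.
  by rewrite subrr normr0 mulr0.
rewrite ge0_integralZl//; last exact/measurable_EFinP.
rewrite integral_indic// setIT /= lebesgue_measure_itv/= lte_fin.
case: ifPn => [_|]; first by rewrite EFinM.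
by rewrite mule0 lee_fin mulr_ge0// subr_ge0.
Qed.

End dW_lemmas.

(** * Stochastic Lanczos quadrature *)

Lemma measure_bigsetU_le_sum (d : measure_display) (T : measurableType d) (R : realType)
    (mu : {measure set T -> \bar R}) (I : Type) (s : seq I) (A : I -> set T) :
  (forall i, measurable (A i)) ->
  (mu (\big[setU/set0]_(i <- s) A i) <= \sum_(i <- s) mu (A i))%E.
Proof.
move=> mA; elim: s => [|i s IHs]; first by rewrite !big_nil measure0.
rewrite !big_cons (le_trans (measureU2 _ _ _))//; first exact: bigsetU_measurable.
exact: leeD2l.
Qed.

Lemma mutually_independent_mulmx (d : measure_display) (T : measurableType d)
    (R : realType) (n N : nat) (P : probability T R) (v : 'I_N -> T -> 'cV[R]_n)
    (Q : 'M[R]_n) :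
  mutually_independent P v -> mutually_independent P (fun i w => Q *m v i w).
Proof.
move=> indep B mB.
pose q (x : n.-tuple R) := col2tup (Q *m \col_i tnth x i).
have mq : measurable_fun [set: n.-tuple R] q.
  apply/measurable_fun_tnthP => i.
  have -> : (@tnth n R)^~ i \o q = (fun x => \sum_j Q i j * tnth x j).
    apply/funext => x /=; rewrite col2tupE mxE; apply: eq_bigr => j _.
    by rewrite mxE.
  by apply: measurable_sum => j; apply: measurable_funM => //; exact: measurable_tnth.
have qE c : q (col2tup c) = col2tup (Q *m c).
  rewrite /q; congr (col2tup (_ *m _)).
  by apply/colP => i; rewrite mxE col2tupE.
have e i : [set w | B i (col2tup (Q *m v i w))] = [set w | (q @^-1` B i) (col2tup (v i w))].
  by apply/funext => w /=; rewrite qE.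
rewrite (eq_bigcapr (fun i _ => e i)) (indep (fun i => q @^-1` B i)); first by apply: eq_bigr => i _; rewrite e.
by move=> i; rewrite -[X in measurable X]setTI; exact: mq.
Qed.

Lemma wCESM_step_cdf (R : realType) (n : nat) (U : 'M[R]_n) (lam : 'I_n -> R)
    (v : 'cV[R]_n) :
  wCESM U lam v = step_cdf lam (fun l => ((U^T *m v) l 0) ^+ 2).
Proof.
apply/funext => x; rewrite /wCESM /spec_proj_le /step_cdf.
have -> : v^T *m (U *m diag_mx (\row_i indic_le (lam i) x) *m U^T) *m v =
    (U^T *m v)^T *m diag_mx (\row_i indic_le (lam i) x) *m (U^T *m v).
  by rewrite trmx_mul trmxK !mulmxA.
rewrite mxE; apply: eq_bigr => l _; rewrite mul_mx_diag !mxE.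
by rewrite expr2; ring.
Qed.

Lemma CESM_step_cdf (R : realType) (n : nat) (lam : 'I_n -> R) :
  CESM lam = step_cdf lam (fun=> n%:R^-1).
Proof. by apply/funext => x; rewrite /CESM mulr_sumr. Qed.

Lemma lam_itv (R : realType) (n : nat) (lam : 'I_n -> R) (i : 'I_n) :
  lam_min lam <= lam i <= lam_max lam.
Proof. by rewrite /lam_min /lam_max bigmin_le_cond//= le_bigmax_cond. Qed.

(** The index [l] is that of the largest eigenvalue below [x]. It is the same for all weights, so
    comparing two step functions on [lam] reduces to comparing them at the eigenvalues. *)
Lemma step_cdf_floor (R : realType) (n : nat) (lam : 'I_n -> R) (x : R) :
  (forall w, step_cdf lam w x = 0) \/
  exists l, forall w, step_cdf lam w x = step_cdf lam w (lam l).
Proof.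
have [/existsP[l0 l0x]|/existsPn nx] := boolP [exists l, lam l <= x]; last first.
  left=> w; rewrite /step_cdf big1// => l _.
  by rewrite /indic_le (negbTE (nx l)) mulr0.
right; have [l lx lmax] := @arg_maxP _ _ _ l0 (fun l => lam l <= x) lam l0x.
exists l => w; apply: eq_bigr => j _; congr (_ * _); rewrite /indic_le.
by congr (if _ then _ else _); apply/idP/idP => [/lmax//|/le_trans]; apply.
Qed.

Lemma dW_CESM_le (R : realType) (n N : nat) (lam : 'I_n -> R) (w : 'I_N -> 'I_n -> R)
    (tau : R) :
  (0 < n)%N -> (0 < N)%N -> (forall i, \sum_l w i l = 1) ->
  (forall l, `|CESM lam (lam l) - N%:R^-1 * \sum_i step_cdf lam (w i) (lam l)| <= tau) ->
  (dW (CESM lam) (fun x => N%:R^-1 * \sum_i step_cdf lam (w i) x)%R <=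
    (tau * (lam_max lam - lam_min lam))%:E)%E.
Proof.
move=> n0 N0 w1 close.
have tau0 : 0 <= tau by apply: le_trans (close (Ordinal n0)).
have NR : N%:R != 0 :> R by rewrite pnatr_eq0 -lt0n.
rewrite CESM_step_cdf in close *.
apply: dW_le_itv => //.
- by case/andP: (lam_itv lam (Ordinal n0)) => /le_trans; apply.
- exact: measurable_step_cdf.
- apply: measurable_funM => //; apply: measurable_sum => i; exact: measurable_step_cdf.
- move=> x /negP; rewrite negb_and -ltNge -leNgt => /orP[xa|bx].
    have out c : step_cdf lam c x = 0.
      rewrite /step_cdf big1// => l _; rewrite /indic_le.
      by case/andP: (lam_itv lam l) => /(lt_le_trans xa); rewrite ltNge => /negbTE ->; rewrite mulr0.
    by rewrite out big1 ?mulr0.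
  have out c : step_cdf lam c x = \sum_l c l.
    apply: eq_bigr => l _; rewrite /indic_le.
    by case/andP: (lam_itv lam l) => _ /le_trans/(_ bx) ->; rewrite mulr1.
  rewrite out; under [in RHS]eq_bigr do rewrite out w1.
  by rewrite !sumr_const !card_ord mulVf// -[LHS]mulr_natr mulVf// pnatr_eq0 -lt0n.
move=> x _; have [out|[l lE]] := step_cdf_floor lam x.
  by rewrite out big1 ?mulr0 ?subr0 ?normr0.
by rewrite lE; under eq_bigr do rewrite lE; exact: close.
Qed.

Unset Implicit Arguments.

Theorem theorem1 (R : realType) (n : nat) (A U : 'M[R]_n) (lam : 'I_n -> R)
  (hU : U^T *m U = 1%:M) (hA : A = U *m diag_mx (\row_i lam i) *m U^T)
  (eta t : R) (heta0 : 0 < eta) (heta1 : eta < 1) (ht : 0 < t)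
  (nv k : nat) (hnv0 : (0 < nv)%N) (hk0 : (0 < k)%N)
  (hnv : 4 / ((n + 2)%N%:R * t ^+ 2) * ln (2 * n%:R / eta) < nv%:R)
  (hk : 12 / t + 2^-1 < k%:R)
  (d : measure_display) (T : measurableType d) (P : probability T R)
  (v : 'I_nv -> T -> 'cV[R]_n)
  (hmeas : forall i, random_vector (v i))
  (hunif : forall i, uniform_on_sphere P (v i))
  (hindep : mutually_independent P v) :
  exists E : set T, measurable E /\
    [set w | ((t * spec_width lam)%:E <
             dW (CESM lam)
                (fun x => (nv%:R^-1 * \sum_(i < nv) GQ k (wCESM U lam (v i w)) x)%R))%E]
      `<=` E /\
    (P E < eta%:E)%E.
Proof.
have n0 : (0 < n)%N.
  (* In dimension [0] the sum of squares is empty and never [1], so the sphere event would have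
     probability [0]. *)
  rewrite lt0n; apply/eqP => n0; have [+ _] := hunif (Ordinal hnv0).
  rewrite (_ : [set w | _] = set0) ?measure0.
    by move/eqP; rewrite eq_sym onee_eq0.
  apply/seteqP; split => // w /=; rewrite big1.
    by move/eqP; rewrite eq_sym oner_eq0.
  move=> i _; suff : (i < 0)%N by [].
  by rewrite -[X in (_ < X)%N]n0 ltn_ord.
have nR : 0 < n%:R :> R by rewrite ltr0n.
have nvR : 0 < nv%:R :> R by rewrite ltr0n.
pose u i w := U^T *m v i w.
have UU : U^T^T *m U^T = 1%:M by rewrite trmxK; exact: mulmx1C.
have mu i : random_vector (u i) by exact: random_vector_mulmx.
have hu i : uniform_on_sphere P (u i) by exact: uniform_on_sphere_mulmx.
have indep : mutually_independent P u by exact: mutually_independent_mulmx.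
pose tau := t / 2; have tau0 : 0 <= tau by rewrite divr_ge0// ltW.
(* With this set, [#|A_ l| / n] is the value of [Phi] at [lam l], and the mass of [u i] on it is
   that of [Psi_i]. *)
pose A_ (l : 'I_n) : {set 'I_n} := [set j | lam j <= lam l]%SET.
pose tails l := tail_event u (A_ l) tau `|` tail_event u (~: A_ l)%SET tau.
pose E0 := \big[setU/set0]_(i < nv) ~` unit_event (u i).
pose E1 := \big[setU/set0]_(l < n) tails l.
have mtails l : measurable (tails l) by apply: measurableU; exact: measurable_tail_event.
have mE0 : measurable E0.
  by apply: bigsetU_measurable => i _; apply: measurableC; exact: measurable_unit_event.
have mE1 : measurable E1 by exact: bigsetU_measurable.
(* The bad event is covered by a measurable one: [E0] is a null set, and outside [E0] and [E1] every
   vector has norm one and none of the [2 n] tails occurs. *)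
exists (E0 `|` E1); split; first exact: measurableU.
split; last first.
  pose q : R := expR (- (nv%:R * (n + 2)%:R * tau ^+ 2)).
  have PE0 : P E0 = 0%E.
    apply/eqP; rewrite eq_le measure_ge0 andbT.
    apply: le_trans (measure_bigsetU_le_sum _ _ _) _.
      by move=> i; apply: measurableC; exact: measurable_unit_event.
    rewrite big1// => i _.
    suff : P (~` unit_event (u i)) = 0%E by [].
    rewrite probability_setC; last exact: measurable_unit_event.
    by rewrite (probability_unit_event (hu i)) subee.
  have Ptail B : (P (tail_event u B tau) <= q%:E)%E.
    rewrite -(fineK (fin_num_measure P _ (measurable_tail_event mu B tau))) lee_fin.
    exact: tail_event_le.
  have PE1 : (P E1 <= (n%:R * (2 * q))%:E)%E.
    apply: le_trans (measure_bigsetU_le_sum _ _ mtails) _.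
    apply: (@le_trans _ _ (\sum_(l < n) (2 * q)%:E)%E).
      apply: lee_sum => l _.
      apply: le_trans (measureU2 _ (measurable_tail_event _ _ _) (measurable_tail_event _ _ _)) _ => //.
      by rewrite mulr_natl mulr2n EFinD; apply: leeD; exact: Ptail.
    by rewrite sumEFin sumr_const card_ord (mulr_natl (2 * q) n).
  have PU : (P (E0 `|` E1) <= P E0 + P E1)%E by exact: measureU2.
  apply: (le_lt_trans PU); rewrite PE0 add0e (le_lt_trans PE1)// lte_fin.
  have q0 : 0 < 2 * n%:R / eta by rewrite divr_gt0// mulr_gt0.
  (* After taking logarithms, this is the hypothesis on [nv] with [tau = t / 2]. *)
  have : q < eta / (2 * n%:R).
    rewrite -[X in _ < X]lnK ?posrE ?divr_gt0 ?mulr_gt0// ltr_expR.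
    rewrite -[eta / _]invrK lnV ?posrE ?invr_gt0 ?divr_gt0 ?mulr_gt0// invf_div ltrN2.
    have n2 : 0 < (n + 2)%:R :> R by rewrite ltr0n; lia.
    have c0 : 0 < (n + 2)%:R * t ^+ 2 by rewrite mulr_gt0// exprn_gt0.
    have -> : nv%:R * (n + 2)%:R * tau ^+ 2 = nv%:R * ((n + 2)%:R * t ^+ 2 / 4).
      by rewrite /tau; field.
    rewrite -ltr_pdivrMr ?divr_gt0//; apply: le_lt_trans hnv.
    rewrite le_eqVlt; apply/orP; left; apply/eqP.
    by field; rewrite !gt_eqF.
  rewrite ltr_pdivlMr ?mulr_gt0//; apply: le_lt_trans.
  by rewrite le_eqVlt; apply/orP; left; apply/eqP; ring.
move=> w /= dWw; apply: contrapT => /not_orP[nE0 nE1].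
have unit i : unit_event (u i) w.
  apply: contrapT => h; apply: nE0.
  by rewrite /E0 -bigcup_seq; exists i => //; rewrite /= mem_index_enum.
have tail l : ~ tails l w.
  move=> h; apply: nE1.
  by rewrite /E1 -bigcup_seq; exists l => //; rewrite /= mem_index_enum.
move: dWw; apply/negP; rewrite -leNgt.
pose W i l := (u i w l 0) ^+ 2.
have W1 i : \sum_l W i l = 1 by exact: unit.
have W0 i l : 0 <= W i l by exact: sqr_ge0.
have gq i : exists th c : 'I_k -> R, (forall j, 0 <= c j) /\ GQ k (wCESM U lam (v i w)) = step_cdf th c /\
    forall p : {poly R}, (size p <= 2 * k)%N ->
      \sum_l W i l * p.[lam l] = \sum_j c j * p.[th j].
  have [th [c [c0 [cE cp]]]] := GQ_spec lam hk0 (W0 i).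
  exists th, c; split=> //; split; first by rewrite wCESM_step_cdf.
  by move=> p szp; exact: cp.
have ab : lam_min lam <= lam_max lam.
  by case/andP: (lam_itv lam (Ordinal n0)) => /le_trans; apply.
have GQm i : measurable_fun [set: R] (GQ k (wCESM U lam (v i w))).
  by have [th [c [_ [-> _]]]] := gq i; exact: measurable_step_cdf.
have GQd i : (dW (step_cdf lam (W i)) (GQ k (wCESM U lam (v i w))) <=
    ((lam_max lam - lam_min lam) * (3 / k%:R))%:E)%E.
  have [th [c [c0 [-> cp]]]] := gq i.
  by apply: dW_quadrature_le => // l; exact: lam_itv.
have step1 : (dW (CESM lam) (fun x => nv%:R^-1 * \sum_i step_cdf lam (W i) x)%R <=
    (tau * (lam_max lam - lam_min lam))%:E)%E.
  apply: dW_CESM_le => // l.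
  have CE : CESM lam (lam l) = #|A_ l|%:R / n%:R.
    rewrite /CESM mulrC; congr (_ / _); rewrite -sum1_card natr_sum [RHS]big_mkcond/=.
    by apply: eq_bigr => j _; rewrite inE /indic_le; case: ifP.
  have SE i : step_cdf lam (W i) (lam l) = sqr_mass (u i) (A_ l) w.
    rewrite /sqr_mass [RHS]big_mkcond/=; apply: eq_bigr => j _; rewrite inE /indic_le.
    by case: ifP; rewrite ?mulr1 ?mulr0.
  have SC i : sqr_mass (u i) (~: A_ l)%SET w = 1 - sqr_mass (u i) (A_ l) w.
    rewrite -(sqr_massC _ (unit i)).
    by apply: eq_bigl => j; rewrite inE.
  have cC : #|(~: A_ l)%SET|%:R / n%:R = 1 - #|A_ l|%:R / n%:R :> R.
    apply/eqP; rewrite eq_sym subr_eq -mulrDl -natrD addnC cardsC card_ord.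
    by rewrite divff// gt_eqF.
  have [nT nTC] : ~ (tail_event u (A_ l) tau) w /\ ~ (tail_event u (~: A_ l)%SET tau) w.
    by split=> h; apply: (tail l); [left|right].
  have h1 : \sum_i sqr_mass (u i) (A_ l) w < nv%:R * (#|A_ l|%:R / n%:R + tau).
    by rewrite ltNge; apply/negP => h; apply: nT; split=> // i _; exact: unit.
  (* The complementary masses sum to [nv] minus the masses on [A_ l], so excluding the upper tail of
     the complement gives the lower bound. *)
  have h2 : nv%:R - \sum_i sqr_mass (u i) (A_ l) w < nv%:R * (1 - #|A_ l|%:R / n%:R + tau).
    rewrite ltNge; apply/negP => h; apply: nTC; split=> [i _|/=]; first exact: unit.
    rewrite cC; under eq_bigr do rewrite SC.
    by rewrite sumrB sumr_const card_ord.
  under eq_bigr do rewrite SE.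
  rewrite CE; move: h1 h2; set X := \sum_i _; set p := _ / n%:R => h1 h2.
  have -> : p - nv%:R^-1 * X = (nv%:R * p - X) / nv%:R by field; rewrite gt_eqF.
  rewrite normrM [`|nv%:R^-1|]gtr0_norm ?invr_gt0// ler_pdivrMr// ler_norml.
  by apply/andP; split; lra.
have step2 := dW_mean hnv0 (fun i => measurable_step_cdf lam (W i)) GQm GQd.
apply: le_trans (dW_triangle (G := fun x => nv%:R^-1 * \sum_i step_cdf lam (W i) x) _ _ _) _.
- by rewrite CESM_step_cdf; exact: measurable_step_cdf.
- apply: measurable_funM => //; apply: measurable_sum => i; exact: measurable_step_cdf.
- apply: measurable_funM => //; exact: measurable_sum.
apply: le_trans (leeD step1 step2) _.
rewrite -EFinD lee_fin /spec_width ger0_norm ?subr_ge0//.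
rewrite [t * _]mulrC [tau * _]mulrC -mulrDr ler_wpM2l ?subr_ge0//.
have kR : 0 < k%:R :> R by rewrite ltr0n.
(* The hypothesis on [k] even gives [3 / k < t / 4]; half of the share reserved for quadrature is
   left over. *)
have : 3 / k%:R <= t / 2.
  rewrite ler_pdivrMr//; have : 12 / t < k%:R by lra.
  by rewrite ltr_pdivrMr//; lra.
by rewrite /tau; lra.
Qed.
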